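(* Let $X$ be a locally compact Hausdorff space with countable base and let $G\colon X\times X\to[0,\infty]$ be a Borel measurable function with $G>0$ satisfying (1) and (2) of the context. Let $P\subset X$ and let $P_0$ be a countable dense set in $P$ (so $P_0\subset P$). The following are equivalent: (i) $P$ is a $G_\delta$-set and $c^\ast(P)=0$. (ii) There exists $\mu\in\mathcal M(P)$ such that $\{x\in X: G\mu(x)=\infty\}=P$. (iii) There exists $\mu\in\mathcal M(P_0)$ such that $\{x\in X: G\mu(x)=\infty\}=P$.
   Context: Assumptions on $G$: (1) For every $x\in X$, $\lim_{y\to x}G(x,y)=G(x,x)=\infty$, and $G(x,\cdot)$ is bounded outside every neighborhood of $x$. (2) $G$ has the local triangle property: every point of $X$ admits an open neighborhood $U$ such that the restriction $G|_{U\times U}$ has the triangle property, that is, there is $C>0$ (depending on $U$) with $\min\{G(x,z),G(y,z)\}\le C\,G(x,y)$ for all $x,y,z\in U$. For a Borel set $B\subset X$, $\mathcal M(B)$ denotes the set of all finite positive Radon measures $\mu$ on $X$ with $\mu(X\setminus B)=0$, and $\|\mu\|$ denotes the total mass of $\mu$. For $\mu\in\mathcal M(X)$ and $x\in X$, $G\mu(x):=\int G(x,y)\,d\mu(y)$; this is a Borel function of $x$, so in (ii) the set $P=\{G\mu=\infty\}$ is Borel and the notation $\mathcal M(P)$ makes sense (statement (ii) means: there is $\mu\in\mathcal M(X)$ with $\{G\mu=\infty\}=P$ and $\mu(X\setminus P)=0$). For $A\subset X$, $c^\ast(A):=\inf\{\|\mu\|:\mu\in\mathcal M(X),\ G\mu\ge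 1\text{ on }A\}$ (with $\inf\emptyset=\infty$). *)

(* Defs.v *)
From mathcomp Require Import all_boot all_order all_algebra.
From mathcomp Require Import all_classical all_reals all_analysis.
From mathcomp Require Import measurable_realfun.

Set Implicit Arguments.
Unset Strict Implicit.
Unset Printing Implicit Defensive.

Import Order.TTheory GRing.Theory Num.Theory.

Local Open Scope classical_set_scope.
Local Open Scope ring_scope.
Local Open Scope ereal_scope.

(* Spaces are [ptopologicalType]s (nonempty, with a distinguished point) only
   because every [measurableType] is pointed. *)
Notation borelType T := (g_sigma_algebraType (@open T%type)).

Section Kernel.
Context (R : realType) (X : ptopologicalType).
Implicit Types (G : X -> X -> \bar R) (U A B P : set X).
Implicit Types mu : {finite_measure set (borelType X) -> \bar R}.

(* The Borel sets of [X * X] are those of the product topology. *)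
Definition borel_kernel G :=
  measurable_fun [set: borelType (X * X)]
    (fun z : borelType (X * X) => G z.1 z.2).

(* [nbhs x] contains the point [x] itself, which is harmless since
   [G x x = +oo]. *)
Definition singular_on_diagonal G :=
  forall x, G x x = +oo /\ G x y @[y --> x] --> +oo.

Definition bounded_off_diagonal G :=
  forall x V, nbhs x V ->
    exists M : R, forall y, ~ V y -> G x y <= M%:E.

Definition triangle_property_on U G :=
  exists2 C : R, (0 < C)%R &
    forall x y z, U x -> U y -> U z -> mine (G x z) (G y z) <= C%:E * G x y.

Definition local_triangle_property G :=
  forall x0, exists U, [/\ open U, U x0 & triangle_property_on U G].

(* Local finiteness is automatic, the measures [mu] being finite. *)
Definition radon mu :=
  forall B : set (borelType X), measurable B ->
    mu B = ereal_sup [set mu K | K in [set K | @compact X K /\ K `<=` B]].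

(* M(B); meaningful for Borel sets [B] only, as [mu] carries no information
   outside the sigma-algebra. *)
Definition radon_on B : set {finite_measure set (borelType X) -> \bar R} :=
  [set mu | radon mu /\ mu (~` B) = 0].

Definition potential G mu (x : X) : \bar R := \int[mu]_y G x y.

Definition cstar G A : \bar R :=
  ereal_inf [set mu [set: borelType X] | mu in
    [set mu | radon_on [set: X] mu /\
              forall x, A x -> 1 <= potential G mu x]].

Definition countable_dense_in (P0 P : set X) :=
  [/\ countable P0, P0 `<=` P & P `<=` closure P0].

End Kernel.

(* Main.v *)
From HB Require Import structures.
Require Import Defs.
From mathcomp Require Import all_boot all_order all_algebra.
From mathcomp Require Import all_classical all_reals all_analysis.
From mathcomp Require Import measurable_realfun borel_hierarchy.
From mathcomp Require Import lra.

(** The kernel [G] behaves like a negative power of a distance.  Where the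
    triangle property holds with constant [C], it is symmetric up to the factor
    [C], and [min (G x y) (G y z) <= C ^+ 2 * G x z] ([kernel_sym],
    [kernel_tri]).  Although [G] is only Borel, truncated potentials
    [\int min (G x y) N dmu(y)] are therefore lower semicontinuous up to a
    constant ([truncated_bulk]), and this is all the regularity that is needed.

    (ii) implies (i): the set of infinite potential is the intersection of the
    interiors of the sets where the potential is at least [n], and small
    multiples of the measure show that [c* (P) = 0].  (iii) implies (ii)
    because P, being a G-delta set, is Borel.

    (i) implies (iii): the problem is local, and locally it is solved in three
    steps.

    Sweeping ([sweep]).  Given a measure [mu] of small mass with potential at
    least 1 on [P], move each point [y] to a point [f y] of [P0] such that
    [G x (f y) >= c * min (G x y) (l y)] for all [x] in [P], with a level [l y] of
    our choice: [f y] is almost nearest to [y], up to the resolution [l y]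
    ([project_levels]).  The truncation at [l y] may lose a part of the potential.
    In the open set where truncated potentials are already large, locally
    uniformly, suitable levels lose nothing ([resolved_cover]).  Outside this set
    the potential of [mu] is finite, so that by Egorov's theorem there are levels
    with small tails ([excess_uniformly_small]), and a maximum principle carries
    the smallness of the tails over to the points of [P] ([truncation_loss]).

    Concentration ([concentrate]).  The potential of a measure on [P0] which is
    large on [P] may be infinite at further points.  Cover the open set where
    it is locally large by a locally finite family of sets, each so small that
    it looks like a point, and move the mass in each of them to a single point
    of [P0].  The potential stays large on [P], and it becomes finite off [P0].

    Layers ([layer_measure], [exact_local]).  If [W n] are open sets that decrease
    to [P], concentrated measures can be chosen with potential at least a fixed
    constant on [P] and at most [e / 2 ^ n.+1] off [W n].  The sum of these
    measures has infinite potential exactly on [P]. *)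

Set Implicit Arguments.
Unset Strict Implicit.
Unset Printing Implicit Defensive.

Import Order.TTheory GRing.Theory Num.Theory.

Local Open Scope classical_set_scope.
Local Open Scope ring_scope.
Local Open Scope ereal_scope.

(** * Countable locally finite refinements *)

Section topology.
Context {X : ptopologicalType}.
Hypotheses (lcX : locally_compact [set: X]) (hX : hausdorff_space X).
Hypothesis scX : @second_countable X.

Lemma locally_compact_hausdorff_regular : @regular_space X.
Proof.
move=> x; have [V] := lcX (x := x) I.
by rewrite withinET => Vx [cV _]; exact: compact_regular cV Vx.
Qed.

Lemma open_shrink (W : set X) x : open W -> W x ->
  exists V, [/\ open V, V x & closure V `<=` W].
Proof.
move=> oW Wx; have /(_ W) := locally_compact_hausdorff_regular (a := x).
case; first exact: open_nbhs_nbhs.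
move=> V Vx VW; exists V°; split; first exact: open_interior.
  exact: Vx.
by apply: subset_trans VW; apply: closureS; exact: interior_subset.
Qed.

Lemma basis_sequence : exists B : nat -> set X,
  (forall i, open (B i)) /\
  forall x W, open W -> W x -> exists i, B i x /\ B i `<=` W.
Proof.
have [B cB [oB bB]] := scX.
have /pfcard_geP[B0|/unsquash f] := cB.
  by case: (bB point setT filterT) => U [BU _]; rewrite B0 in BU.
exists (fun i => f i); split=> [i|x W oW Wx].
  by apply: oB; exact: funS.
have [|V [/= BV Vx] VW] := bB x W; first exact: open_nbhs_nbhs.
have [i _ fi] := 'surj_f BV.
by exists i; rewrite fi.
Qed.

(** Measures are going to be moved or added piece by piece; local finiteness
    keeps all but finitely many pieces away from a given point of [W], and the
    boundedness of the kernel off the diagonal then controls their potential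
    there.  The pieces are good open sets [U i] minus the closures of finitely
    many basic sets [B j], [j < i].  Basic sets whose closure fits into a good
    open set cover [W], and [B j] meets none of the later pieces. *)
Lemma locally_finite_refinement (W : set X) (good : set X -> Prop) :
  good set0 -> (forall U V, U `<=` V -> good V -> good U) ->
  (forall x, W x -> exists U, [/\ open U, U x, U `<=` W & good U]) ->
  exists O : nat -> set X,
  [/\ forall i, open (O i) /\ good (O i),
      W = \bigcup_i O i &
      forall x, W x -> exists V n, [/\ open V, V x &
        forall i, (n < i)%N -> O i `&` V = set0]].
Proof.
move=> good0 goodS Wgood.
have [B [oB bB]] := basis_sequence.
pose fits i U := [/\ open U, U `<=` W, good U & closure (B i) `<=` U].
have /choice[U UP] : forall i, exists V,
    fits i V \/ V = set0 /\ ~ exists V', fits i V'.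
  move=> i; have [[V]|noV] := pselect (exists V, fits i V).
    by exists V; left.
  by exists set0; right.
(* indices of basic sets that fit nowhere are discarded *)
pose Z i := if pselect (fits i (U i)) then closure (B i) else set0.
have clZ i : closed (Z i).
  by rewrite /Z; case: pselect => ? /=; [exact: closed_closure|exact: closed0].
have ZU i : Z i `<=` U i.
  by rewrite /Z; case: pselect => /= [[]|_ //].
have oU i : open (U i) by case: (UP i) => [[]//|[-> _]]; exact: open0.
have cover x : W x -> exists i, fits i (U i) /\ B i x.
  move=> Wx; have [V [oV Vx VW gV]] := Wgood x Wx.
  have [V' [oV' V'x V'V]] := open_shrink oV Vx.
  have [i [Bix BiV']] := bB x V' oV' V'x.
  exists i; split=> //; case: (UP i) => // -[_ []]; exists V; split => //.
  by apply: subset_trans V'V; exact: closureS.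
have oO i : open (U i `\` \bigcup_(j in `I_i) Z j).
  rewrite setDE; apply: openI => //; apply: closed_openC.
  by apply: closed_bigcup => // j _.
exists (fun i => U i `\` \bigcup_(j in `I_i) Z j); split.
- move=> i; split=> //.
  by apply: (goodS _ (U i)); [exact: subDsetl|case: (UP i) => [[]//|[-> _]]].
- apply/seteqP; split=> [x Wx|x [i _ [Uix _]]]; last first.
    by move: Uix; case: (UP i) => [[_ + _ _]|[-> //]]; apply.
  have Ux : exists i, `[< U i x >].
    have [i [[_ _ _ BU] Bix]] := cover x Wx.
    by exists i; apply/asboolP; apply: BU; exact: subset_closure.
  case: (ex_minnP Ux) => i /asboolP Uix mini.
  exists i => //; split=> // -[j /= ji Zjx].
  have /asboolP/mini : U j x by exact: ZU.
  by rewrite leqNgt ji.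
- move=> x /cover[i [fi Bix]]; exists (B i), i; split=> // j ij.
  rewrite -subset0 => y [[_ ZjP] Biy]; apply: ZjP; exists i => //.
  by rewrite /Z; case: pselect => // ?; exact: subset_closure.
Qed.

End topology.

(** * Borel sets and Borel kernels *)

Section borel.
Context {X : ptopologicalType}.

Lemma borel_open (U : set X) :
  open U -> measurable (U : set (borelType X)).
Proof. by move=> oU; exact: sub_sigma_algebra. Qed.

Lemma borel_closed (U : set X) :
  closed U -> measurable (U : set (borelType X)).
Proof.
by move=> cU; rewrite -[U]setCK; apply: measurableC; apply: borel_open;
   exact: closed_openC.
Qed.

Lemma borel_countable (hX : hausdorff_space X) (A : set X) :
  countable A -> measurable (A : set (borelType X)).
Proof.
move=> cA; apply: (@countable_measurable _ (borelType X)) => // x.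
by apply: borel_closed; exact: (accessible_closed_set1 (hausdorff_accessible hX)).
Qed.

Lemma borel_Gdelta (A : set X) :
  Gdelta A -> measurable (A : set (borelType X)).
Proof.
move=> [F oF ->]; apply: (@bigcapT_measurable _ (borelType X)) => i.
exact: borel_open.
Qed.

End borel.

Section borel_product.
Context {X : ptopologicalType}.

Lemma continuous_borel_pair (Y Z : ptopologicalType) (f : X -> Y * Z) :
  continuous f ->
  measurable_fun [set: borelType X] (f : borelType X -> borelType (Y * Z)).
Proof.
move=> cf; apply: (@measurability _ _ (borelType X) (borelType (Y * Z)) setT f
  (@open (Y * Z)%type)) => [//|_ [U oU <-]].
by rewrite setTI; apply: borel_open; move/continuousP: cf => /(_ U oU).
Qed.

(** Tonelli needs the product sigma-algebra, while [borel_kernel] refers to the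
    Borel sets of the product topology; second countability makes every open
    set of the product a countable union of open rectangles. *)
Lemma borel_prod (Y : ptopologicalType) (scX : @second_countable X)
    (scY : @second_countable Y) :
  (@measurable _ (borelType (X * Y)%type) : set (set (X * Y))) `<=`
    @measurable _ (borelType X * borelType Y)%type.
Proof.
apply: smallest_sub; first exact: sigma_algebra_measurable.
move=> W oW.
have [B [oB bB]] := basis_sequence scX.
have [D [oD bD]] := basis_sequence scY.
pose F (i : nat * nat) := if `[< B i.1 `*` D i.2 `<=` W >] then B i.1 `*` D i.2 else set0.
have -> : W = \bigcup_i F i.
  apply/seteqP; split=> [[x y] Wxy|z [i _]]; last first.
    by rewrite /F; case: asboolP => // iW; exact: iW.
  have [[U V] /= [Ux Vy] UVW] : nbhs (x, y) W by exact: open_nbhs_nbhs.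
  move: Ux Vy; rewrite nbhsE => -[U' [oU' U'x] U'U]; rewrite nbhsE => -[V' [oV' V'y] V'V].
  have [i [Bix BiU]] := bB x _ oU' U'x.
  have [j [Djy DjV]] := bD y _ oV' V'y.
  exists (i, j) => //; rewrite /F asboolT//= => -[a b] [/= Bia Djb].
  by apply: UVW; split; [exact/U'U/BiU|exact/V'V/DjV].
apply: countable_bigcupT_measurable => // i; rewrite /F; case: ifP => _ //.
by apply: (@measurableX _ _ (borelType X) (borelType Y));
  [exact: (borel_open (oB _))|exact: (borel_open (oD _))].
Qed.

End borel_product.

Section kernel_measurability.
Context (R : realType) (X : ptopologicalType).
Variable G : X -> X -> \bar R.
Hypothesis mG : borel_kernel G.

Lemma borel_kernel_section x :
  measurable_fun [set: borelType X] (G x : borelType X -> \bar R).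
Proof.
apply: (@measurableT_comp _ _ _ _ _ _ (fun z : borelType (X * X) => G z.1 z.2)
  _ (fun y : borelType X => (x, y) : borelType (X * X))); first exact: mG.
apply: (@continuous_borel_pair X X X (fun y => (x, y))) => y.
by apply: cvg_pair => //; exact: cvg_cst.
Qed.

Lemma borel_kernel_section2 y :
  measurable_fun [set: borelType X] (G^~ y : borelType X -> \bar R).
Proof.
apply: (@measurableT_comp _ _ _ _ _ _ (fun z : borelType (X * X) => G z.1 z.2)
  _ (fun x : borelType X => (x, y) : borelType (X * X))); first exact: mG.
apply: (@continuous_borel_pair X X X (fun x => (x, y))) => x.
by apply: cvg_pair => //; exact: cvg_cst.
Qed.

Lemma borel_kernel_prod (scX : @second_countable X) :
  measurable_fun [set: borelType X * borelType X]
    (fun z : borelType X * borelType X => G z.1 z.2).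
Proof.
move=> _ B mB; rewrite setTI; apply: (borel_prod scX scX).
by rewrite -[X in measurable X]setTI; exact: mG.
Qed.

End kernel_measurability.

(** * Countable series and transport of measures *)

Section series.
Context (R : realType).
Implicit Types u : nat -> \bar R.

Lemma nneseries_term u k : (forall i, 0 <= u i) -> u k <= \sum_(i <oo) u i.
Proof.
by move=> u0; rewrite (nneseriesD1 (n := k))// leeDl// nneseries_ge0.
Qed.

(** The form in which sums of potentials are shown to be finite: finitely many
    terms are only known to be finite, the others are bounded by the masses of
    the summands. *)
Lemma nneseries_lty u n (M : R) : (forall i, 0 <= u i) -> (0 <= M)%R ->
  (forall i, (i <= n)%N -> u i < +oo) ->
  (forall i, (n < i)%N -> u i <= (M / (2 ^ i.+1)%:R)%:E) ->
  \sum_(i <oo) u i < +oo.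
Proof.
move=> u0 M0 fin tail.
rewrite (@nneseries_split _ _ 0 n.+1)//; apply: lte_add_pinfty.
  by rewrite big_nat; apply: lte_sum_pinfty => i /andP[_]; rewrite add0n ltnS => /fin.
apply: (@le_lt_trans _ _ M%:E); last exact: ltry.
apply: le_trans (epsilon_trick0 xpredT M0).
rewrite [leRHS](@nneseries_split _ _ 0 n.+1)//; last first.
  by move=> k _; rewrite lee_fin divr_ge0.
rewrite add0n; apply: (@le_trans _ _ (\sum_(n.+1 <= i <oo) (M / (2 ^ i.+1)%:R)%:E)).
  rewrite -(nneseries_addn n.+1 u0) -(nneseries_addn (f := fun i => (M / (2 ^ i.+1)%:R)%:E)).
    by apply: lee_nneseries => // i _; apply: tail; exact: ltn_addl.
  by move=> i; rewrite lee_fin divr_ge0.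
by rewrite leeDr// sume_ge0// => i _; rewrite lee_fin divr_ge0.
Qed.

Lemma nneseries_infty u (c : R) : (0 < c)%R -> (forall i, c%:E <= u i) ->
  \sum_(i <oo) u i = +oo.
Proof.
move=> c0 cu; have u0 i : 0 <= u i by rewrite (le_trans _ (cu i))// lee_fin ltW.
apply/eqyP => A A0; have uk k : (c *+ k)%:E <= \sum_(i <oo) u i.
  apply: le_trans (nneseries_lim_ge (m := 0) k _) => //.
  elim: k => [|k IH]; first by rewrite big_geq.
  by rewrite big_nat_recr//= mulrSr EFinD leeD.
apply: le_trans (uk (Num.bound (A / c))); rewrite lee_fin -mulr_natr mulrC.
rewrite -ler_pdivrMr//; apply: ltW; apply: le_lt_trans (archi_boundP _); first by [].
by rewrite divr_ge0 ?ltW.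
Qed.

End series.

Section transport.
Context d (T : measurableType d) (R : realType).
Implicit Types mu : {measure set T -> \bar R}.

Lemma ge0_integral_carrier mu (D : set T) (f : T -> \bar R) :
  measurable D -> mu (~` D) = 0 -> measurable_fun setT f ->
  (forall x, 0 <= f x) ->
  \int[mu]_x f x = \int[mu]_(x in D) f x.
Proof.
move=> mD D0 mf f0; have mDC : measurable (~` D) by exact: measurableC.
rewrite -(setUv D) ge0_integral_setU//.
- rewrite [X in _ + X]null_set_integral ?adde0//.
  exact: measurable_funTS.
- by rewrite setUv.
- by apply/disj_setPS => x [].
Qed.

Lemma transport_measure mu (f : T -> T) (mf : measurable_fun [set: T] f) :
  exists nu : {measure set T -> \bar R},
    (forall B, nu B = mu (f @^-1` B)) /\
    forall g : T -> \bar R, measurable_fun setT g -> (forall x, 0 <= g x) ->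
      \int[nu]_x g x = \int[mu]_x g (f x).
Proof.
unshelve eexists (pushforward mu f : measure T R); first exact: mf.
by split=> // g mg g0; rewrite ge0_integral_pushforward// preimage_setT.
Qed.

Lemma sum_measures (m : nat -> {measure set T -> \bar R}) :
  exists nu : {measure set T -> \bar R},
    (forall B, measurable B -> nu B = \sum_(n <oo) m n B) /\
    forall g : T -> \bar R, measurable_fun setT g -> (forall x, 0 <= g x) ->
      \int[nu]_x g x = \sum_(n <oo) \int[m n]_x g x.
Proof.
exists (mseries m 0); split=> [B mB//|g mg g0].
by rewrite ge0_integral_measure_series.
Qed.

Lemma combine_measures (m : nat -> {measure set T -> \bar R}) (A : set T) (e : R) :
  measurable A -> (0 <= e)%R -> (forall n, m n (~` A) = 0) ->
  (forall n, m n setT <= (e / (2 ^ n.+1)%:R)%:E) ->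
  exists nu : {measure set T -> \bar R},
  [/\ nu (~` A) = 0, nu setT <= e%:E &
    forall g : T -> \bar R, measurable_fun setT g -> (forall x, 0 <= g x) ->
      \int[nu]_x g x = \sum_(n <oo) \int[m n]_x g x].
Proof.
move=> mA e0 mA0 mT; have [nu [nuE nuint]] := sum_measures m.
exists nu; split => //.
  by rewrite nuE ?eseries0//; exact: measurableC.
rewrite nuE//; apply: le_trans (epsilon_trick0 xpredT e0).
exact: lee_nneseries.
Qed.

End transport.

(** A substitute for the nearest point to [x] in a set: [G x] need not attain
    its supremum there, but its truncations almost do. *)
Lemma almost_maximizer (R : realType) (T : Type) (D : set T) (f : T -> \bar R) (M : R) :
  D !=set0 -> (forall y, D y -> 0 <= f y <= M%:E) ->
  exists2 y0, D y0 & forall y, D y -> f y <= 2%:E * f y0.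
Proof.
move=> [d Dd] fM; pose s := ereal_sup (f @` D).
have s0 : 0 <= s.
  by have /andP[f0 _] := fM _ Dd; rewrite (le_trans f0)//; apply: ereal_sup_ubound; exists d.
have sM : s <= M%:E by apply: ge_ereal_sup => _ [y Dy <-]; case/andP: (fM _ Dy).
have sup y : D y -> f y <= s by move=> Dy; apply: ereal_sup_ubound; exists y.
have sfin : s \is a fin_num by rewrite ge0_fin_numE// (le_lt_trans sM)// ltry.
have [s_eq0|s_neq0] := eqVneq s 0.
  exists d => // y Dy; rewrite (le_trans (sup _ Dy))// s_eq0 mule_ge0//.
  by case/andP: (fM _ Dd).
have s_gt0 : (0 < fine s)%R by rewrite fine_gt0// lt_def s_neq0 s0 -ge0_fin_numE.
have [_ [y0 Dy0 <-] hy0] : exists2 y, (f @` D) y & (fine s / 2)%:E < y.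
  by apply: ereal_sup_gt; rewrite -/s -{2}(fineK sfin) lte_fin ltr_pdivrMr// ltr_pMr// ltr1n.
exists y0 => // y /sup/le_trans; apply.
rewrite -(fineK sfin) -[fine s](@mulfVK _ 2%R)// mulrC EFinM.
by rewrite lee_wpmul2l// ltW.
Qed.

(** Measurable selection from countably many measurable conditions. *)
Lemma measurable_first_index d (T : measurableType d) (Q : nat -> set T) :
  (forall n, measurable (Q n)) ->
  exists2 j : T -> nat, measurable_fun setT j &
    forall y, (exists n, Q n y) -> Q (j y) y.
Proof.
move=> mQ; pose ind y := exists n, `[< Q n y >].
pose j y := if pselect (ind y) is left h then ex_minn h else 0%N.
have jQ y n : Q n y -> Q (j y) y /\ (j y <= n)%N.
  move=> Qny; rewrite /j; case: pselect => [h|[]]; last by exists n; apply/asboolP.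
  by case: ex_minnP => m /asboolP Qmy mmin; split => //; apply: mmin; apply/asboolP.
exists j; last by move=> y [n Qny]; case: (jQ _ _ Qny).
have mj n : measurable [set y | j y = n].
  pose E := (Q n `\` \bigcup_(m in `I_n) Q m) `|`
    (if n == 0%N then ~` \bigcup_m Q m else set0).
  have mE : measurable E.
    apply: measurableU; first by apply: measurableD => //; exact: bigcup_measurable.
    by case: ifP => // _; apply: measurableC; exact: bigcupT_measurable.
  rewrite (_ : [set _ | _] = E)//; apply/seteqP; split=> [y /= jyn|y].
    have [[m Qmy]|noQ] := pselect (exists m, Q m y).
      left; split; first by rewrite -jyn; case: (jQ _ _ Qmy).
      by move=> [k /= kn /jQ[_]]; rewrite jyn leqNgt kn.
    right; have -> : n = 0%N.
      rewrite -jyn /j; case: pselect => // h; have [k /asboolP Qky] := h.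
      by exfalso; apply: noQ; exists k.
    by rewrite eqxx => -[k _ Qky]; apply: noQ; exists k.
  case=> [[Qny noQ]|]; last first.
    case: eqP => // -> noQ /=; rewrite /j; case: pselect => // h; have [k /asboolP Qky] := h.
    by exfalso; apply: noQ; exists k.
  apply/eqP; rewrite eqn_leq; have [Qjy -> /=] := jQ _ _ Qny.
  by rewrite leqNgt; apply/negP => jn; apply: noQ; exists (j y).
move=> _ B _; rewrite setTI.
rewrite (_ : _ @^-1` B = \bigcup_(n in B) [set y | j y = n]).
  exact: bigcup_measurable.
by apply/seteqP; split=> [y By|y [n Bn /= ->]//]; exists (j y).
Qed.

Lemma nonempty_countable_range (X : Type) (A0 : set X) : countable A0 -> A0 !=set0 ->
  exists p : nat -> X, range p = A0.
Proof.
move=> cA /set0P/eqP A0n; have /pfcard_geP[//|/unsquash p] := cA.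
exists p; apply/seteqP; split=> [_ [k _ <-]|x A0x]; first exact: funS.
by have [k _ <-] := 'surj_p A0x; exists k.
Qed.

Lemma measurable_nat_comp (X : ptopologicalType) (j : borelType X -> nat) (q : nat -> X) :
  measurable_fun setT j -> measurable_fun setT (q \o j : borelType X -> borelType X).
Proof.
move=> mj _ B mB; rewrite setTI comp_preimage -[X in measurable X]setTI.
exact: mj.
Qed.

(** * Potentials of carried measures *)

Section carried_potential.
Context (R : realType) (X : ptopologicalType).
Hypothesis hX : hausdorff_space X.
Variable G : X -> X -> \bar R.
Hypothesis G0 : forall x y, 0 < G x y.
Hypothesis mG : borel_kernel G.
Hypothesis Gbnd : bounded_off_diagonal G.

Lemma potential_le_mass (nu : {measure set (borelType X) -> \bar R})
    (A : set X) x (M : R) :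
  countable A -> nu (~` A) = 0 -> (0 <= M)%R -> (forall y, A y -> G x y <= M%:E) ->
  \int[nu]_y G x y <= M%:E * nu setT.
Proof.
move=> cA nuA M0 AM; have mGx := borel_kernel_section mG x.
have Gge0 y : 0 <= G x y by exact: ltW.
have mA : measurable (A : set (borelType X)).
  exact: borel_countable.
rewrite (ge0_integral_carrier mA)//.
apply: (@le_trans _ _ (\int[nu]_(y in A) M%:E)).
  by apply: ge0_le_integral => //; exact: measurable_funTS.
by rewrite integral_cst// lee_wpmul2l// le_measure ?inE.
Qed.

Lemma carrier_subset (nu : {measure set (borelType X) -> \bar R}) (A B : set X) :
  countable B -> A `<=` B -> nu (~` A) = 0 -> nu (~` B) = 0.
Proof.
move=> cB AB nuA; have cA : countable A by apply: sub_countable cB; exact: subset_card_le.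
apply: (subset_measure0 _ _ _ nuA).
- by apply: (@measurableC _ (borelType X)); exact: borel_countable.
- by apply: (@measurableC _ (borelType X)); exact: borel_countable.
- exact: subsetC.
Qed.

Lemma bounded_off_nbhs x (V : set X) : open V -> V x ->
  exists2 M : R, (0 <= M)%R & forall y, ~ V y -> G x y <= M%:E.
Proof.
move=> oV Vx; have [|M MP] := Gbnd (x := x) (V := V); first exact: open_nbhs_nbhs.
exists (Num.max M 0)%R; first by rewrite le_max lexx orbT.
by move=> y /MP/le_trans; apply; rewrite lee_fin le_max lexx.
Qed.

Lemma kernel_lty x y : x <> y -> G x y < +oo.
Proof.
move=> /eqP xy; move: hX; rewrite open_hausdorff => /(_ _ _ xy)[[V W]/=].
rewrite !inE => -[Vx Wy] [oV oW VW].
have [|M MP] := Gbnd (x := x) (V := V); first exact: open_nbhs_nbhs.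
apply: le_lt_trans (MP y _) (ltry _) => Vy.
by have : (V `&` W) y by []; rewrite VW.
Qed.

End carried_potential.

(** * Kernels with the triangle property *)

Section triangle_kernel.
Context (R : realType) (X : ptopologicalType).
Hypotheses (lcX : locally_compact [set: X]) (hX : hausdorff_space X).
Hypothesis scX : @second_countable X.
Variables (G : X -> X -> \bar R) (U : set X) (C : R).
Hypotheses (C2 : (2 <= C)%R) (G0 : forall x y, 0 < G x y).
Hypothesis mG : borel_kernel G.
Hypothesis Gsing : singular_on_diagonal G.
Hypothesis Gbnd : bounded_off_diagonal G.
Hypothesis oU : open U.
Hypothesis tri : forall x y z, U x -> U y -> U z ->
  mine (G x z) (G y z) <= C%:E * G x y.

Let C1 : (1 <= C)%R. Proof. by rewrite (le_trans _ C2)// ler1n. Qed.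
Let C0 : (0 < C)%R. Proof. exact: lt_le_trans C1. Qed.
Let Ck k : (0 < C ^+ k)%R. Proof. exact: exprn_gt0. Qed.
Let Gge0 x y : 0 <= G x y. Proof. exact: ltW. Qed.
Let mU : measurable (U : set (borelType X)). Proof. exact: borel_open. Qed.
Let mGx x : measurable_fun [set: borelType X] (G x : borelType X -> \bar R).
Proof. exact: borel_kernel_section. Qed.

(** All estimates lose powers of [C] only; [lec k] records how many, and the
    assumption [2 <= C] lets it absorb factors [2] as well. *)
Definition lec (k : nat) (a b : \bar R) := a <= (C ^+ k)%:E * b.

Lemma exprC_ge0 k : 0 <= (C ^+ k)%:E. Proof. by rewrite lee_fin exprn_ge0// ltW. Qed.

Lemma lec_trans b k l a c : lec k a b -> lec l b c -> lec (k + l) a c.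
Proof.
move=> ab bc; rewrite /lec exprD EFinM -muleA (le_trans ab)//.
by rewrite lee_wpmul2l ?exprC_ge0.
Qed.

Lemma lec_refl k a : 0 <= a -> lec k a a.
Proof. by move=> a0; rewrite /lec lee_pemull// lee_fin exprn_ege1. Qed.

Lemma lec_le k a b : 0 <= b -> a <= b -> lec k a b.
Proof. by move=> b0 /le_trans; apply; exact: lec_refl. Qed.

Lemma lec_min k a b a' b' : lec k a b -> lec k a' b' ->
  lec k (mine a a') (mine b b').
Proof.
rewrite /lec => ab ab'.
have /orP[bb'|bb'] := le_total b b'.
  by rewrite (min_idPl bb') ge_min ab.
by rewrite (min_idPr bb') ge_min ab' orbT.
Qed.

Lemma lec_min2 k a b b' : lec k a b -> lec k a b' -> lec k a (mine b b').
Proof. by move=> ab ab'; have := lec_min ab ab'; rewrite minxx. Qed.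

Lemma lec_double a b : a <= 2%:E * b -> 0 <= b -> lec 1 a b.
Proof. by move=> /le_trans + b0; apply; rewrite expr1 lee_wpmul2r. Qed.

(** Take [z = x] in the triangle property and use [G x x = +oo]. *)
Lemma kernel_sym x y : U x -> U y -> lec 1 (G y x) (G x y).
Proof.
by move=> Ux Uy; have := tri Ux Uy Ux; rewrite (Gsing x).1 /lec expr1 min_r ?leey.
Qed.

(** With [G] replaced by its reciprocal this is a quasi-metric inequality; it
    is the only form in which the triangle property is used from here on. *)
Lemma kernel_tri x y z : U x -> U y -> U z ->
  lec 2 (mine (G x y) (G y z)) (G x z).
Proof.
move=> Ux Uy Uz; apply: (@lec_trans (mine (G x y) (G z y)) 1 1).
  by apply: lec_min; [apply: lec_refl; exact: ltW|exact: kernel_sym].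
by rewrite /lec expr1; exact: tri.
Qed.

(** Truncated kernels are lower semicontinuous up to a constant: once
    [x] is so close to [y] that [G x y] exceeds the truncation level, moving
    from [y] to [x] costs a factor [C ^+ 2] only. *)
Lemma kernel_truncate_near N x y z : 0 <= N -> U x -> U y -> U z -> N <= G x y ->
  lec 2 (mine (G y z) N) (mine (G x z) N).
Proof.
move=> N0 Ux Uy Uz Nxy; apply: lec_min2; last first.
  by apply: lec_le => //; rewrite ge_min lexx orbT.
apply: le_trans (kernel_tri Ux Uy Uz); rewrite minC.
by rewrite le_min !ge_min Nxy lexx orbT.
Qed.

Lemma lec_lt k (a b : \bar R) (M : R) :
  lec k a b -> (C ^+ k * M)%:E < a -> M%:E < b.
Proof.
move=> ab /lt_le_trans/(_ ab).
by rewrite EFinM lte_pmul2l// lte_fin Ck.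
Qed.

Lemma kernel_large_near x (M : R) : \forall y \near x, M%:E < G x y.
Proof. by have [_ /cvgey_gt] := Gsing x; apply. Qed.

(** Boundedness off the diagonal is assumed for a fixed first argument; the
    triangle property turns it into a bound that is locally uniform, with the
    arguments exchanged. *)
Lemma kernel_bounded_away (B : set X) y : open B -> B y -> B `<=` U ->
  exists (V : set X) (M : R), [/\ open V, V y, V `<=` B, (0 <= M)%R &
    forall x z, U x -> ~ B x -> V z -> G x z <= M%:E].
Proof.
move=> oB By BU; have Uy := BU _ By.
have [M M_ge0 MP] := bounded_off_nbhs Gbnd oB By.
have : nbhs y (B `&` [set x | (C ^+ 4 * M)%:E < G y x]).
  by apply: filterI; [exact: open_nbhs_nbhs|exact: kernel_large_near].
rewrite nbhsE => -[V [oV Vy] VB]; exists V, (C ^+ 3 * M)%R; split=> //.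
- by move=> x /VB[].
- by rewrite mulr_ge0// ltW// Ck.
move=> x z Ux Bx /VB[Bz /= Mz]; have Uz := BU _ Bz.
have zy : (C ^+ 3 * M)%:E < G z y.
  by apply: lec_lt (kernel_sym Uz Uy) _; rewrite mulrA -exprS.
have : mine (G x z) (G z y) <= (C ^+ 3 * M)%:E.
  rewrite EFinM; apply: (@le_trans _ _ ((C ^+ 3)%:E * G y x)).
    apply: (lec_trans (k := 2) (l := 1)); last exact: (kernel_sym Uy Ux).
    exact: kernel_tri.
  by rewrite lee_pmul2l ?MP// lte_fin Ck.
rewrite ge_min => /orP[//|/(lt_le_trans zy)].
by rewrite ltxx.
Qed.

(** * The open set where truncated potentials are locally large *)

Section bulk.
Variable mu : {measure set (borelType X) -> \bar R}.
Variable D : set (borelType X).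
Hypotheses (mD : measurable D) (DU : D `<=` U).

Definition truncated (x : X) (N : nat) : \bar R :=
  \int[mu]_(y in D) mine (G x y) N%:R%:E.

Let mGD x : measurable_fun D (G x : borelType X -> \bar R).
Proof. by apply: measurable_funTS; exact: borel_kernel_section. Qed.

Let mtrunc x (N : \bar R) : measurable_fun D (fun y : borelType X => mine (G x y) N).
Proof. by apply: measurable_mine => //; exact: mGD. Qed.

Let trunc_ge0 x y (N : nat) : 0 <= mine (G x y) N%:R%:E.
Proof. by rewrite le_min ltW// lee_fin ler0n. Qed.

Lemma truncated_cvg x : truncated x N @[N --> \oo] --> \int[mu]_(y in D) G x y.
Proof.
have lim y : mine (G x y) N%:R%:E @[N --> \oo] --> G x y.
  have [Goo|Gfin] := eqVneq (G x y) +oo.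
    rewrite Goo; apply/cvgeyPge => A; near=> N.
    rewrite min_r ?leey// lee_fin; near: N.
    exact: nbhs_infty_ger.
  have Gf : G x y \is a fin_num.
    by rewrite ge0_fin_numE ?ltW// lt_neqAle Gfin leey.
  apply: cvg_near_cst; near=> N; rewrite min_l//.
  rewrite -(fineK Gf) lee_fin; near: N; exact: nbhs_infty_ger.
have := @cvg_monotone_convergence _ _ _ mu D mD
  (fun N (y : borelType X) => mine (G x y) N%:R%:E).
rewrite (_ : (fun _ => limn _) = G x); last first.
  by apply/funext => y; apply/cvg_lim => //; exact: lim.
by apply => // y _ m n mn; rewrite le_min !ge_min lexx/= lee_fin ler_nat mn orbT.
Unshelve. all: by end_near. Qed.

Lemma truncated_le x N : truncated x N <= \int[mu]_(y in D) G x y.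
Proof.
by apply: ge0_le_integral => // y _; rewrite ge_min lexx.
Qed.

Lemma truncated_large x (t : R) : t%:E < \int[mu]_(y in D) G x y ->
  exists N, t%:E <= truncated x N.
Proof.
move=> tG; apply: contrapT => /forallNP tN; move: tG; apply/negP; rewrite -leNgt.
rewrite -(cvg_lim _ (@truncated_cvg x))//; apply: lime_le.
  by apply/cvg_ex; eexists; exact: truncated_cvg.
by apply: nearW => N; rewrite leNgt; apply/negP => /ltW; exact: tN.
Qed.

(** The potential need not be lower semicontinuous, so [bulk t] plays the role of
    the open set where it exceeds [t].  One truncation level [N] has to work on
    a whole neighbourhood: [bulk t] is where the level needed to reach [t] is
    locally bounded. *)
Definition bulk (t : R) : set X := [set x | exists B N,
  [/\ open B, B x, B `<=` U & forall x', B x' -> t%:E <= truncated x' N]].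

Lemma open_bulk t : open (bulk t).
Proof.
rewrite openE => x [B [N [oB Bx BU Bt]]]; rewrite /interior nbhsE.
exists B => // y By; exists B, N; split => //.
Qed.

Lemma truncated_bulk t y N : U y -> (C ^+ 2 * t)%:E <= truncated y N -> bulk t y.
Proof.
move=> Uy ty.
have : nbhs y (U `&` [set x | (C * N%:R)%:E < G y x]).
  by apply: filterI; [exact: open_nbhs_nbhs|exact: kernel_large_near].
rewrite nbhsE => -[B [oB By] BV]; exists B, N; split=> //.
  by move=> x /BV[].
move=> x /BV[Ux /= Nx].
have Nxy : N%:R%:E <= G x y.
  have := lt_le_trans Nx (kernel_sym Ux Uy).
  by rewrite expr1 EFinM lte_pmul2l// => /ltW.
have : truncated y N <= (C ^+ 2)%:E * truncated x N.
  rewrite /truncated -ge0_integralZl//; last by rewrite lee_fin ltW.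
  apply: ge0_le_integral => //; first exact: measurable_funeM.
  by move=> z /DU Uz; apply: (kernel_truncate_near _ Ux Uy Uz Nxy);
     rewrite lee_fin.
by move=> /(le_trans ty); rewrite EFinM lee_pmul2l// lte_fin Ck.
Qed.

(** In particular the potential is finite at all points of [U] outside the bulk,
    for every threshold [t]. *)
Lemma potential_infty_bulk t y : U y -> \int[mu]_(z in D) G y z = +oo -> bulk t y.
Proof.
move=> Uy yoo; have [|N tN] := @truncated_large y (C ^+ 2 * t).
  by rewrite yoo ltry.
exact: truncated_bulk tN.
Qed.

Variables (A : set X) (t : R) (Nx : X -> nat).

(** [B] is so small compared with the level [L] that it may be treated as a
    point: [G] is at least [L] inside [B], while [L] exceeds everything that is
    seen of [B] from a point [x], either of [A], where truncation at [Nx x] is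
    harmless, or of [U] outside the bulk. *)
Definition resolved (L : R) (B : set X) :=
  [/\ (0 <= L)%R, forall x y, B x -> B y -> L%:E <= G x y,
      forall x y, A x -> B y -> mine (G x y) (Nx x)%:R%:E <= L%:E &
      forall x y, U x -> ~ bulk t x -> B y -> G x y <= L%:E].

Hypothesis AU : A `<=` U.
Hypothesis Nmin : forall x N, A x -> t%:E <= truncated x N -> (Nx x <= N)%N.

(** Near a point [y] of the bulk, [Nx] is bounded by one level [N0]; points far
    from [y] see a neighbourhood of [y] below some bound [M].  Take [L] to be the
    larger of the two, and then shrink the neighbourhood. *)
Lemma bulk_resolved y : bulk t y ->
  exists B, [/\ open B, B y, B `<=` bulk t & exists L, resolved L B].
Proof.
move=> [B0 [N0 [oB0 B0y B0U B0t]]].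
have Uy := B0U _ B0y.
have B0S : B0 `<=` bulk t by move=> x B0x; exists B0, N0.
have [V [M [oV Vy VB0 M0 far]]] := kernel_bounded_away oB0 B0y B0U.
pose L := (Num.max N0%:R M)%R.
have L0 : (0 <= L)%R by rewrite le_max ler0n.
have ML : (M <= L)%R by rewrite le_max lexx orbT.
have N0L : (N0%:R <= L)%R by rewrite le_max lexx.
have : nbhs y (V `&` [set x | (C ^+ 3 * L)%:E < G y x]).
  by apply: filterI; [exact: open_nbhs_nbhs|exact: kernel_large_near].
rewrite nbhsE => -[B [oB By] BV].
have BB0 : B `<=` B0 by move=> x /BV[/VB0].
have farL x z : U x -> ~ B0 x -> B z -> G x z <= L%:E.
  move=> Ux B0x /BV[Vz _]; apply: (le_trans (far _ _ Ux B0x Vz)).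
  by rewrite lee_fin.
exists B; split=> //; first by move=> x /BB0/B0S.
exists L; split => //.
- move=> x z /[dup] /BB0 B0x /BV[_ /= Lx] /[dup] /BB0 B0z /BV[_ /= Lz].
  have [Ux Uz] := (B0U _ B0x, B0U _ B0z).
  have xy : (C ^+ 2 * L)%:E < G x y.
    apply: (lec_lt (kernel_sym Ux Uy)).
    by rewrite mulrA -exprS.
  have yz : (C ^+ 2 * L)%:E < G y z.
    by apply: le_lt_trans Lz; rewrite lee_fin ler_wpM2r// ler_weXn2l.
  apply/ltW/(lec_lt (kernel_tri Ux Uy Uz)).
  by rewrite lt_min xy yz.
- move=> x z Ax Bz; have [B0x|B0x] := pselect (B0 x).
    rewrite ge_min; apply/orP; right.
    by rewrite lee_fin (le_trans _ N0L)// ler_nat Nmin//; exact: B0t.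
  by rewrite ge_min farL//; exact: AU.
- by move=> x z Ux /[swap] Bz nb; apply: farL => // /B0S.
Qed.

Lemma resolved_cover : exists (B : nat -> set X) (L : nat -> R),
  [/\ forall i, open (B i), forall i, resolved (L i) (B i),
      bulk t = \bigcup_i B i &
      forall x, bulk t x -> exists V n, [/\ open V, V x &
        forall i, (n < i)%N -> B i `&` V = set0]].
Proof.
have [|V W VW [L [L0 LG LN Lb]]||B [oB Bcov Bfin]] :=
  @locally_finite_refinement X lcX hX scX (bulk t) (fun B => exists L, resolved L B).
- by exists 0%R; split=> // [x y []|x y _ []|x y _ _ []].
- exists L; split=> // [x y /VW Wx /VW|x y Ax /VW|x y Ux nb /VW];
    [exact: LG|exact: LN|exact: Lb].
- by move=> x /bulk_resolved.
have /choice[L BL] : forall i, exists L, resolved L (B i).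
  by move=> i; case: (oB i).
by exists B, L; split => // i; case: (oB i).
Qed.

End bulk.

(** * Concentrating a measure on a locally finite set of points *)

Section concentrate.
Variable mu : {measure set (borelType X) -> \bar R}.

Lemma least_levels (D : set (borelType X)) (A : set X) (t : R) :
  (forall x, A x -> exists N, t%:E <= truncated mu D x N) ->
  exists Nx : X -> nat, forall x, A x -> t%:E <= truncated mu D x (Nx x) /\
    forall N, t%:E <= truncated mu D x N -> (Nx x <= N)%N.
Proof.
move=> At; have /choice[Nx NxP] : forall x, exists n, A x ->
    t%:E <= truncated mu D x n /\
    forall N, t%:E <= truncated mu D x N -> (n <= N)%N.
  move=> x; have [Ax|nAx] := pselect (A x); last by exists 0%N.
  by case: (ex_minnP (At x Ax)) => n tn nmin; exists n.
by exists Nx.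
Qed.

Variables (A A0 : set X) (t : R).
Hypotheses (AU : A `<=` U) (A0A : A0 `<=` A) (cA0 : countable A0).
Hypotheses (muA0 : mu (~` A0) = 0) (mu_fin : mu setT < +oo).
Hypothesis muA : forall x, A x -> (C ^+ 2 * t)%:E < \int[mu]_y G x y.

(** The bulk contains [A] and is covered by resolved sets [B i], locally finitely.
    Moving the mass of each [B i] to one point of [A0] in [B i] does not harm
    the truncated potential on [A], and it multiplies the potential outside the
    bulk, which is finite, by at most [C ^+ 2].  At a point of the bulk outside
    [A0], finitely many of the new points contribute finite values of [G], and
    all the others stay away. *)
Lemma concentrate : A0 !=set0 ->
  exists nu : {measure set (borelType X) -> \bar R},
  [/\ nu (~` A0) = 0, nu setT = mu setT,
      forall x, A x -> t%:E <= (C ^+ 2)%:E * \int[nu]_y G x y &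
      forall x, U x -> ~ A0 x -> \int[nu]_y G x y < +oo].
Proof.
move=> [a0 A0a0].
have mA0 : measurable (A0 : set (borelType X)) by exact: borel_countable.
have A0U : A0 `<=` U by exact: subset_trans AU.
have intE x : \int[mu]_y G x y = \int[mu]_(y in A0) G x y.
  exact: ge0_integral_carrier.
have AS : A `<=` bulk mu A0 t.
  move=> x Ax; have := muA Ax; rewrite intE => /(truncated_large mA0)[N].
  by apply: (truncated_bulk mA0 A0U); exact: AU.
have [|Nx NxP] := @least_levels A0 A t.
  by move=> x /AS[B [N [_ Bx _ BN]]]; exists N; exact: BN.
have Nmin x N : A x -> t%:E <= truncated mu A0 x N -> (Nx x <= N)%N.
  by move=> /NxP[_]; apply.
have [B [L [oB BL SB Bfin]]] := resolved_cover AU Nmin.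
have [|j mj jP] := @measurable_first_index _ (borelType X) B.
  by move=> n; apply: borel_open.
have /choice[q qP] : forall i, exists z, A0 z /\
    (A0 `&` B i !=set0 -> B i z).
  move=> i; have [[z [A0z Biz]]|n0] := pselect (A0 `&` B i !=set0).
    by exists z.
  by exists a0.
pose f := q \o j.
have mf : measurable_fun setT (f : borelType X -> borelType X).
  exact: measurable_nat_comp.
have Bf y : A0 y -> B (j y) y /\ B (j y) (f y).
  move=> A0y; have Bjy : B (j y) y.
    apply: jP; have := AS _ (A0A A0y); rewrite SB => -[i _ Biy]; by exists i.
  by split => //; apply: (qP (j y)).2; exists y.
have fA0 y : A0 (f y) := (qP (j y)).1.
have mGf x : measurable_fun setT (fun y : borelType X => G x (f y)).
  apply: (@measurableT_comp _ _ _ _ _ _ (G x : borelType X -> \bar R) _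
    (f : borelType X -> borelType X)) => //.
have [nu [nuE nuint]] := transport_measure mu mf.
have nuGE x : \int[nu]_y G x y = \int[mu]_(y in A0) G x (f y).
  by rewrite nuint//; exact: ge0_integral_carrier.
have mGfA0 x : measurable_fun (A0 : set (borelType X)) (fun y : borelType X => G x (f y)).
  exact: measurable_funTS.
exists nu; split.
- rewrite nuE (_ : _ @^-1` _ = set0) ?measure0//.
  by rewrite -subset0 => y /=; apply; exact: fA0.
- by rewrite nuE preimage_setT.
- move=> x Ax; rewrite nuGE -ge0_integralZl//; last by rewrite lee_fin ltW.
  have [/le_trans + _] := NxP _ Ax; apply; apply: ge0_le_integral => //.
  + by move=> y _; rewrite le_min Gge0 lee_fin ler0n.
  + by apply: measurable_mine => //; exact: measurable_funTS.
  + by apply: measurable_funeM.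
  move=> y A0y; have [Bjy Bjf] := Bf y A0y; have [L0 LG LN _] := BL (j y).
  apply: le_trans (kernel_tri (AU Ax) (A0U _ A0y) (A0U _ (fA0 y))).
  by rewrite le_min ge_min lexx/= (le_trans (LN x y Ax Bjy))// LG.
- move=> x Ux nA0x; have [xS|xS] := pselect (bulk mu A0 t x); last first.
    have Gfin : \int[mu]_(y in A0) G x y < +oo.
      rewrite ltNge; apply/negP; rewrite leye_eq => /eqP Goo; apply: xS.
      exact: (potential_infty_bulk mA0 A0U).
    rewrite nuGE; apply: (@le_lt_trans _ _ ((C ^+ 2)%:E * \int[mu]_(y in A0) G x y)).
      rewrite -ge0_integralZl//; last 2 first.
        by apply: measurable_funTS.
        by rewrite lee_fin ltW.
      apply: ge0_le_integral => //.
        by apply: measurable_funeM; exact: measurable_funTS.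
      move=> y A0y; have [Bjy Bjf] := Bf y A0y; have [L0 LG _ Lb] := BL (j y).
      apply: le_trans (kernel_tri Ux (A0U _ (fA0 y)) (A0U _ A0y)).
      by rewrite le_min lexx/= (le_trans (Lb _ _ Ux xS Bjf))// LG.
    rewrite lte_mul_pinfty// ?lee_fin ?ltW// ltry.
  have [V [n [oV Vx Vn]]] := Bfin x xS.
  have [|M MP] := Gbnd (x := x) (V := V); first exact: open_nbhs_nbhs.
  have Gq_fin i : G x (q i) \is a fin_num.
    rewrite ge0_fin_numE// (kernel_lty hX Gbnd)// => xq; apply: nA0x.
    by rewrite xq; case: (qP i).
  have [M' M'P] : exists M' : R, forall i, (i <= n)%N -> G x (q i) <= M'%:E.
    elim: n {Vn} => [|n [M' M'P]].
      exists (fine (G x (q 0%N))) => i; rewrite leqn0 => /eqP ->.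
      by rewrite fineK.
    exists (Num.max M' (fine (G x (q n.+1))))%R => i; rewrite leq_eqVlt => /predU1P[->|].
      by rewrite EFin_max le_max fineK ?lexx ?orbT.
    by move=> /M'P/le_trans; apply; rewrite lee_fin le_max lexx.
  rewrite nuGE; apply: (@le_lt_trans _ _ (\int[mu]_(y in A0) (Num.max M M')%:E)).
    apply: ge0_le_integral => //.
    move=> y A0y; have [_ Bjf] := Bf y A0y.
    have [jn|nj] := leqP (j y) n.
      by apply: (le_trans (M'P _ jn)); rewrite lee_fin le_max lexx orbT.
    rewrite (@le_trans _ _ M%:E)//; last by rewrite lee_fin le_max lexx.
    by apply: MP => Vf; have : (B (j y) `&` V) (f y) by []; rewrite Vn.
  rewrite integral_cst//; apply: (@le_lt_trans _ _ (`|(Num.max M M')%:E| * mu A0)).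
    by rewrite lee_wpmul2r// lee_abs.
  rewrite lte_mul_pinfty// (le_lt_trans _ mu_fin)//.
  by apply: le_measure => //; rewrite inE//; exact: measurableT.
Qed.

End concentrate.

(** * Sweeping a measure onto a countable dense set *)

(** The point [p (k y)] is almost as near to [y] as any [p i], up to the
    resolution [l y].  Since every [x] in the closure of the [p i] is a limit of
    such points, [y] may be replaced by [p (k y)] when seen from [x], except
    that [G x y] gets truncated at [l y].  No better can be hoped for when [y]
    itself is a limit of the [p i]. *)
Lemma project_levels (p : nat -> X) (l : borelType X -> R) :
  (forall k, U (p k)) -> measurable_fun setT l -> (forall y, (0 <= l y)%R) ->
  exists2 k : borelType X -> nat, measurable_fun setT k &
    forall x y, U x -> closure (range p) x -> U y ->
      lec 6 (mine (G x y) (l y)%:E) (G x (p (k y))).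
Proof.
move=> pU ml l0.
pose Q n : set (borelType X) :=
  \bigcap_k [set y | mine (G y (p k)) (l y)%:E <= 2%:E * G y (p n)].
have [|k mk kP] := @measurable_first_index _ (borelType X) Q.
  move=> n; apply: (@bigcapT_measurable _ (borelType X)) => k.
  rewrite -[X in measurable X]setTI.
  apply: (@measurable_lee _ (borelType X)) => //.
    apply: measurable_mine; first exact: borel_kernel_section2.
    exact/measurable_EFinP.
  by apply: measurable_funeM; exact: borel_kernel_section2.
exists k => // x y Ux px Uy.
have Qk : Q (k y) y.
  apply: kP.
  have [|z|n _ nP] := @almost_maximizer R nat setT
      (fun n => mine (G y (p n)) (l y)%:E) (l y).
  - by exists 0%N.
  - by move=> _; rewrite le_min Gge0 lee_fin l0 ge_min lexx orbT.
  exists n => i _; apply: (le_trans (nP i I)).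
  by rewrite lee_pmul2l// ge_min lexx.
set q := p (k y) in Qk *.
(* transfer the choice of [q] from the points [p i] to their limit [x] *)
have yx : lec 3 (mine (G y x) (l y)%:E) (G y q).
  have [z [[i _ <-] /= lz]] := px _ (kernel_large_near x (l y)).
  apply: (@lec_trans (mine (G y (p i)) (l y)%:E) 2 1).
    apply: lec_min2 => //; last first.
      by apply: lec_le; rewrite ?lee_fin ?l0// ge_min lexx orbT.
    apply: le_trans (kernel_tri Uy Ux (pU i)).
    by rewrite le_min ge_min lexx/= ge_min (ltW lz) orbT.
  by apply: lec_double => //; exact: (Qk i I).
have xy : lec 4 (mine (G x y) (l y)%:E) (mine (G x y) (G y q)).
  apply: lec_min2.
    by apply: lec_le => //; rewrite ge_min lexx.
  apply: (lec_trans (k := 1) (l := 3)) yx.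
  apply: lec_min; first exact: kernel_sym.
  by apply: lec_refl => //; rewrite lee_fin.
apply: (lec_trans (k := 4) (l := 2)) xy _.
exact: (kernel_tri Ux Uy (pU _)).
Qed.

Section sweep.
Variable mu : {finite_measure set (borelType X) -> \bar R}.

(** The part of the potential that truncation at level [N] removes. *)
Definition excess (y : X) (N : nat) : \bar R :=
  \int[mu]_(z in U) (G y z - mine (G y z) N%:R%:E).

Let mGU x : measurable_fun (U : set (borelType X)) (G x : borelType X -> \bar R).
Proof. exact: measurable_funTS. Qed.

Let trunc_ge0 y z (N : nat) : 0 <= mine (G y z) N%:R%:E.
Proof. by rewrite le_min Gge0 lee_fin ler0n. Qed.

Let trunc_fin y z (N : nat) : mine (G y z) N%:R%:E \is a fin_num.
Proof. by rewrite ge0_fin_numE// gt_min ltry orbT. Qed.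

Let excess_int_ge0 y (N : nat) z : 0 <= G y z - mine (G y z) N%:R%:E.
Proof.
by rewrite sube_ge0 ?trunc_fin// ge_min lexx.
Qed.

Let mexcess_int y (N : nat) : measurable_fun (U : set (borelType X))
  (fun z : borelType X => G y z - mine (G y z) N%:R%:E).
Proof. by apply: emeasurable_funB => //; apply: measurable_mine. Qed.

Lemma excess_nonincreasing y : {homo excess y : m n / (m <= n)%N >-> n <= m}.
Proof.
move=> m n mn; apply: ge0_le_integral => // z _.
rewrite leeB// le_min !ge_min lexx/= lee_fin ler_nat mn orbT//.
Qed.

Lemma excess_small y (e : R) : (0 < e)%R -> \int[mu]_(z in U) G y z < +oo ->
  exists N, excess y N <= e%:E.
Proof.
move=> e0 Gfin.
have I0 : 0 <= \int[mu]_(z in U) G y z by exact: integral_ge0.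
have If : \int[mu]_(z in U) G y z \is a fin_num by rewrite ge0_fin_numE.
have [N IN] : exists N, (fine (\int[mu]_(z in U) G y z) - e)%:E <= truncated mu U y N.
  apply: (truncated_large mU).
  by rewrite -[ltRHS]fineK// lte_fin ltrBlDr ltrDl.
have tf : truncated mu U y N \is a fin_num.
  rewrite ge0_fin_numE; last exact: integral_ge0.
  exact: le_lt_trans (truncated_le mu mU y N) Gfin.
exists N; have : \int[mu]_(z in U) G y z = excess y N + truncated mu U y N.
  rewrite /truncated -ge0_integralD//.
  - by apply: eq_integral => z _; rewrite subeK.
  - by apply: measurable_mine.
move=> IE; rewrite -(leeD2rE _ _ tf) -IE -[leLHS]fineK//.
by apply: (le_trans _ (leeD2l e%:E IN)); rewrite -EFinD lee_fin addrC subrK.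
Qed.

Lemma measurable_excess N :
  measurable_fun [set: borelType X] (fun y : borelType X => excess y N).
Proof.
pose f := (fun w : borelType X * borelType X =>
  G w.1 w.2 - mine (G w.1 w.2) N%:R%:E) \_ (setT `*` (U : set (borelType X))).
have mf : measurable_fun setT f.
  apply/(measurable_restrictT _ _).1; first exact: measurableX.
  apply: measurable_funTS; apply: emeasurable_funB; first exact: borel_kernel_prod.
  by apply: measurable_mine => //; exact: borel_kernel_prod.
have f0 w : 0 <= f w by apply: erestrict_ge0 => ? _; exact: excess_int_ge0.
rewrite (_ : (fun _ => _) = fubini_F mu f).
  exact: measurable_fun_fubini_tonelli_F.
apply/funext => y; rewrite /excess /fubini_F [LHS]integral_mkcond.
apply: eq_integral => z _; rewrite /f /patch.
by congr (if _ then _ else _); rewrite in_setX in_setT.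
Qed.

(** Egorov: on the set where the potential is finite, the excess tends to zero
    pointwise, hence it is uniformly small off a set of small measure. *)
Lemma excess_uniformly_small (S : set (borelType X)) (e d : R) :
  measurable S -> (0 < e)%R -> (0 < d)%R ->
  (forall y, U y -> ~ S y -> \int[mu]_(z in U) G y z < +oo) ->
  exists N, mu ((U `\` S) `&` [set y | e%:E < excess y N]) <= d%:E.
Proof.
move=> mS e0 d0 Sfin; pose F N := (U `\` S) `&` [set y | e%:E < excess y N].
have mF N : measurable (F N : set (borelType X)).
  apply: measurableI; first exact: (@measurableD _ (borelType X)).
  rewrite -[X in measurable X]setTI.
  apply: (@measurable_lte _ (borelType X)) => //; exact: measurable_excess.
have capF : \bigcap_N F N = set0.
  rewrite -subset0 => y Fy; have [[Uy Sy] _] := Fy 0%N I.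
  have [N] := excess_small e0 (Sfin y Uy Sy).
  by rewrite leNgt => /negP; apply; have [] := Fy N I.
have : mu (F N) @[N --> \oo] --> mu (\bigcap_N F N).
  apply: nonincreasing_cvg_mu => //.
  - by rewrite -ge0_fin_numE// fin_num_measure.
  - exact: bigcapT_measurable.
  - move=> m n mn; apply/subsetPset => y [Uy /= ey]; split => //=.
    by apply: (lt_le_trans ey); exact: excess_nonincreasing.
rewrite capF measure0 => cF; apply: contrapT => /forallNP nF.
have : d%:E <= 0.
  rewrite -(cvg_lim _ cF)//; apply: lime_ge; first by apply/cvg_ex; exists 0.
  by apply: nearW => N; rewrite leNgt; apply/negP => /ltW; exact: nF.
by rewrite lee_fin leNgt d0.
Qed.

Lemma lec_excess (a : \bar R) (N : nat) : (C * N%:R)%:E < a ->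
  lec 1 a (a - mine a N%:R%:E).
Proof.
case: a => [r||//] CN; last first.
  by rewrite min_r ?leey// addye// /lec expr1 mulry gtr0_sg// mul1e.
have N0 : (0 <= N%:R :> R)%R by rewrite ler0n.
have Nr : (2 * N%:R < r)%R.
  by move: CN; rewrite lte_fin; apply: le_lt_trans; rewrite ler_wpM2r.
have Nr1 : (N%:R <= r)%R by rewrite (le_trans _ (ltW Nr))// ler_peMl// ler1n.
rewrite min_r ?lee_fin// /lec expr1 -EFinB -EFinM lee_fin.
apply: (@le_trans _ _ (2 * (r - N%:R))%R); last by rewrite ler_wpM2r// subr_ge0.
by rewrite mulrBr mulr_natl mulr2n lerBrDr lerD2l ltW.
Qed.

(** A maximum principle.  Restrict the measure to a set [W] on which [G x] is
    large and the excess at level [N] is small.  If [y0] almost maximizes [G x]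
    on [W], then [G x y] is at most a constant times [G y0 y] on [W], and
    [G y0 y] is large there, so that the integral of [G x] over [W] is controlled
    by the excess at [y0], although [x] itself is arbitrary. *)
Lemma truncation_loss (W : set (borelType X)) x (N M : nat) (e : R) :
  measurable W -> W `<=` U -> U x ->
  (forall y, W y -> (C ^+ 4 * N%:R)%:E < G x y) ->
  (forall y, W y -> excess y N <= e%:E) -> (0 <= e)%R ->
  \int[mu]_(y in W) mine (G x y) M%:R%:E <= (C ^+ 5 * e)%:E.
Proof.
move=> mW WU Ux WN We e0.
have [->|/set0P W0] := eqVneq W set0.
  by rewrite integral_set0 lee_fin mulr_ge0// ltW.
have [|y0 Wy0 y0P] := @almost_maximizer R X W (fun y => mine (G x y) M%:R%:E) M%:R W0.
  by move=> y _; rewrite le_min Gge0 lee_fin ler0n/= ge_min lexx orbT.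
have Uy0 := WU _ Wy0.
have tri0 y : W y -> lec 3 (mine (G x y0) (G x y)) (G y0 y).
  move=> Wy; apply: (lec_trans (k := 1) (l := 2)); last first.
    exact: (kernel_tri Uy0 Ux (WU _ Wy)).
  by apply: lec_min; [exact: kernel_sym|exact: lec_refl].
have bound y : W y ->
    lec 5 (mine (G x y) M%:R%:E) (G y0 y - mine (G y0 y) N%:R%:E).
  move=> Wy; apply: (lec_trans (k := 4) (l := 1)); last first.
    apply: lec_excess; apply: (lec_lt (tri0 _ Wy)).
    by rewrite mulrA -exprSr lt_min !WN.
  apply: (lec_trans (k := 1) (l := 3)) (tri0 _ Wy).
  apply: lec_min2.
    by apply: lec_double => //; apply: (le_trans (y0P _ Wy)); rewrite lee_pmul2l// ge_min lexx.
  by apply: lec_le => //; rewrite ge_min lexx.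
have Ege0 z : 0 <= G y0 z - mine (G y0 z) N%:R%:E.
  rewrite sube_ge0 ?ge_min ?lexx//; apply/orP; left.
  by rewrite ge0_fin_numE ?gt_min ?ltry ?orbT// le_min Gge0 lee_fin ler0n.
have mE : measurable_fun [set: borelType X]
    (fun z : borelType X => G y0 z - mine (G y0 z) N%:R%:E).
  by apply: emeasurable_funB => //; exact: measurable_mine.
apply: (@le_trans _ _ ((C ^+ 5)%:E * excess y0 N)); last first.
  by rewrite [leRHS]EFinM lee_pmul2l ?lte_fin// We.
apply: (@le_trans _ _ (\int[mu]_(z in W) ((C ^+ 5)%:E * (G y0 z - mine (G y0 z) N%:R%:E)))).
  apply: ge0_le_integral => //.
  - by apply: measurable_funTS; exact: measurable_mine.
  - by apply: measurable_funTS; exact: measurable_funeM.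
rewrite ge0_integralZl//; last 2 first.
  exact: measurable_funTS.
  by rewrite lee_fin ltW.
rewrite lee_pmul2l ?lte_fin//.
by apply: ge0_subset_integral => //; exact: measurable_funTS.
Qed.

Variables (A A0 : set X) (t : R).
Hypotheses (AU : A `<=` U) (A0U : A0 `<=` U) (cA0 : countable A0).
Hypotheses (AA0 : A `<=` closure A0) (t0 : (0 < t)%R).
Hypothesis muA : forall x, A x -> t%:E < \int[mu]_(y in U) G x y.

(** Each [y] is moved to a point of [A0] by [project_levels], and the level
    [l y] has to be such that the truncations are harmless seen from [A].  In
    the bulk [S], resolved sets provide a level above [min (G x y) (Nx x)].
    Outside [S] the potential is finite, and levels from Egorov's theorem
    make the losses summable, by the maximum principle.  The losses amount to
    at most half of the threshold [t] that is reached at [Nx x]. *)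
Lemma sweep : A0 !=set0 ->
  exists nu : {measure set (borelType X) -> \bar R},
  [/\ nu (~` A0) = 0, nu setT = mu setT &
      forall x, A x -> (t / 2)%:E <= (C ^+ 6)%:E * \int[nu]_y G x y].
Proof.
move=> /(nonempty_countable_range cA0)[p pE].
pose S := bulk mu U t.
have mS : measurable (S : set (borelType X)) by apply: borel_open; exact: open_bulk.
have mUS : measurable (U `\` S : set (borelType X)).
  exact: (@measurableD _ (borelType X)).
have [|Nx NxP] := @least_levels mu U A t.
  by move=> x /muA /(truncated_large mU).
have Nmin x N : A x -> t%:E <= truncated mu U x N -> (Nx x <= N)%N.
  by move=> /NxP[_]; apply.
have [B [L [oB BL SB _]]] := resolved_cover AU Nmin.
pose eta i := (t / 2 / 2 ^+ i.+1 / C ^+ 5)%R.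
have eta0 i : (0 < eta i)%R by rewrite !divr_gt0// exprn_gt0.
have /choice[N NP] : forall i, exists N,
    mu ((U `\` S) `&` [set y | (eta i)%:E < excess y N]) <= (i.+1%:R^-1)%:E.
  move=> i; apply: excess_uniformly_small => //.
  move=> y Uy Sy; rewrite ltNge leye_eq; apply/negP => /eqP Goo; apply: Sy.
  exact: (potential_infty_bulk mU).
pose E i : set (borelType X) := [set y | excess y (N i) <= (eta i)%:E].
have mE i : measurable (E i).
  rewrite -[E i]setTI; apply: (@measurable_lee _ (borelType X)) => //.
  exact: measurable_excess.
pose Q i : set (borelType X) := B i `|` ((U `\` S) `&` E i).
have mQ i : measurable (Q i).
  apply: measurableU; first exact: (borel_open (oB i)).
  exact: (@measurableI _ (borelType X)).
have [j mj jP] := measurable_first_index mQ.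
(* one formula serves both cases, since larger levels are always allowed *)
pose l (y : borelType X) : R := (L (j y) + C ^+ 4 * (N (j y))%:R)%R.
have l0 y : (0 <= l y)%R.
  by rewrite addr_ge0//; [case: (BL (j y))|rewrite mulr_ge0// ltW].
have ml : measurable_fun setT l.
  move=> _ Y mY; rewrite setTI.
  rewrite (_ : _ @^-1` _ = j @^-1` [set n | Y (L n + C ^+ 4 * (N n)%:R)%R])//.
  by rewrite -[X in measurable X]setTI; exact: mj.
have pU k : U (p k) by apply: A0U; rewrite -pE; exists k.
have [k mk kP] := project_levels pU ml l0.
pose f := p \o k.
have mf : measurable_fun setT (f : borelType X -> borelType X).
  exact: measurable_nat_comp.
have [nu [nuE nuint]] := transport_measure mu mf.
have mGf x : measurable_fun setT (fun y : borelType X => G x (f y)).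
  apply: (@measurableT_comp _ _ _ _ _ _ (G x : borelType X -> \bar R) _
    (f : borelType X -> borelType X)) => //.
exists nu; split.
- rewrite nuE (_ : _ @^-1` _ = set0) ?measure0//.
  by rewrite -subset0 => y /=; apply; rewrite -pE; exists (k y).
- by rewrite nuE preimage_setT.
move=> x Ax; rewrite nuint//.
pose g (y : borelType X) := mine (G x y) (Nx x)%:R%:E.
have g0 y : 0 <= g y by rewrite le_min Gge0 lee_fin ler0n.
have mg : measurable_fun setT g by exact: measurable_mine.
pose D : set (borelType X) := U `&` \bigcup_i Q i.
have mD : measurable D.
  by apply: (@measurableI _ (borelType X)) => //; exact: bigcupT_measurable.
pose W := D `&` ~` S `&` [set y | (l y)%:E < G x y].
have mW : measurable W.
  apply: measurableI; first by apply: measurableI => //; exact: measurableC.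
  rewrite -[X in measurable X]setTI; apply: (@measurable_lte _ (borelType X)) => //.
  exact/measurable_EFinP.
have mUD : measurable (U `\` D : set (borelType X)).
  exact: (@measurableD _ (borelType X)).
(* every [y] outside all [Q i] violates all Egorov conditions *)
have muUD : mu (U `\` D) = 0.
  apply/eqP; rewrite eq_le measure_ge0 andbT.
  apply/lee_addgt0Pr => e e0; rewrite add0e.
  have [i ie] : exists i : nat, (i.+1%:R^-1 <= e)%R.
    exists (Num.truncn e^-1); rewrite invf_ple ?posrE//.
    by rewrite ltW// truncnS_gt.
  apply: (@le_trans _ _ (i.+1%:R^-1)%:E); last by rewrite lee_fin.
  apply: le_trans (NP i); apply: le_measure; rewrite ?inE//.
    apply: measurableI => //; rewrite -[X in measurable X]setTI.
    by apply: (@measurable_lte _ (borelType X)) => //; exact: measurable_excess.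
  move=> y [Uy nD]; have nQ n : ~ Q n y by move=> Qn; apply: nD; split=> //; exists n.
  have nS : ~ S y.
    by rewrite /S SB => -[n _ Bn]; apply: (nQ n); left.
  split=> //=; rewrite ltNge; apply/negP => Ei; apply: (nQ i); right; split=> //.
have jQ y : D y -> Q (j y) y by move=> [_ [n _ Qn]]; apply: jP; exists n.
have UE : \int[mu]_(y in U) g y = \int[mu]_(y in D) g y.
  have -> : U = D `|` (U `\` D) by rewrite setDUK// => y [].
  rewrite ge0_integral_setU//.
  - rewrite [X in _ + X]null_set_integral ?adde0//.
    exact: measurable_funTS.
  - exact: measurable_funTS.
  - by apply/disj_setPS => y [? []].
have DE : \int[mu]_(y in D) g y = \int[mu]_(y in D `\` W) g y + \int[mu]_(y in W) g y.
  rewrite -ge0_integral_setU//.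
  - by rewrite setUC setDUK// => y [[]].
  - exact: measurableD.
  - exact: measurable_funTS.
  - by apply/disj_setPS => y [[? ?]].
have main : \int[mu]_(y in D `\` W) g y <= (C ^+ 6)%:E * \int[mu]_y G x (f y).
  rewrite -ge0_integralZl//; last by rewrite lee_fin ltW.
  apply: (@le_trans _ _ (\int[mu]_(y in D `\` W) ((C ^+ 6)%:E * G x (f y)))).
    apply: ge0_le_integral => //.
    - exact: measurableD.
    - exact: measurable_funTS.
    - by apply: measurable_funTS; exact: measurable_funeM.
    move=> y [Dy nW]; have [Uy _] := Dy.
    apply: le_trans (kP x y (AU Ax) _ Uy); last by rewrite pE; exact: AA0.
    rewrite le_min ge_min lexx/=; have [Sy|nS] := pselect (S y).
      case: (jQ y Dy) => [By|[[]]//]; have [_ _ LN _] := BL (j y).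
      apply: le_trans (LN x y Ax By) _.
      by rewrite lee_fin lerDl mulr_ge0// ltW.
    rewrite ge_min leNgt; apply/orP; left; apply/negP => lG; apply: nW.
    by split.
  apply: ge0_subset_integral => //.
  - exact: measurableD.
  - exact: measurable_funeM.
  - by move=> y _; rewrite mule_ge0// lee_fin ltW.
(* the part of the mass that is truncated, split according to the Egorov sets *)
have lossW : \int[mu]_(y in W) g y <= (t / 2)%:E.
  have -> : W = \bigcup_i (W `&` j @^-1` [set i]).
    by apply/seteqP; split=> [y Wy|y [i _ []]//]; exists (j y).
  have mWi i : measurable (W `&` j @^-1` [set i]).
    by apply: measurableI => //; rewrite -[X in measurable X]setTI; exact: mj.
  rewrite ge0_integral_bigcup//; last 2 first.
    by apply: measurable_funTS.
    by apply/trivIsetP => a b _ _ /eqP ab; rewrite -subset0 => y [[_ /= ja] [_ /= jb]];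
       apply: ab; rewrite -ja -jb.
  apply: le_trans (epsilon_trick0 xpredT _); last by rewrite divr_ge0// ltW.
  apply: lee_nneseries => [i _ _|i _]; first exact: integral_ge0.
  have -> : (t / 2 / (2 ^ i.+1)%:R)%R = (C ^+ 5 * eta i)%R.
    by rewrite [RHS]mulrC divfK ?natrX// gt_eqF.
  apply: (truncation_loss (N := N i)) => //.
  - by move=> y [[[[]]]].
  - exact: AU.
  - move=> y [[[Dy nS] /= lG] jy]; apply: le_lt_trans lG.
    by rewrite lee_fin /l jy lerDr; case: (BL i).
  - move=> y [[[Dy nS] _] /= jy]; have := jQ y Dy; rewrite jy => -[By|[_ //]].
    by exfalso; apply: nS; rewrite /S SB; exists i.
  - exact: ltW.
have : t%:E <= (C ^+ 6)%:E * \int[mu]_y G x (f y) + (t / 2)%:E.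
  apply: (le_trans (NxP x Ax).1); rewrite /truncated -/g UE DE.
  exact: leeD.
rewrite -leeBlDr// -EFinB.
by have -> : (t - t / 2 = t / 2)%R by rewrite {1}[t]splitr addrK.
Qed.

End sweep.

(** * Small measures with prescribed infinities, inside U *)

Section exact_local.
Variables P P0 : set X.
Hypothesis P0P : countable_dense_in P0 P.
Hypothesis cP : cstar G P = 0.

Let cP0O (O : set X) : countable (P0 `&` O).
Proof. by have [cP0 _ _] := P0P; apply: sub_countable cP0; exact: subset_card_le. Qed.

Lemma cstar0_measure (e : R) : (0 < e)%R ->
  exists mu : {finite_measure set (borelType X) -> \bar R},
    mu setT <= e%:E /\ forall x, P x -> 1 <= \int[mu]_y G x y.
Proof.
move=> e0; have : cstar G P < e%:E by rewrite cP lte_fin.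
by move=> /ereal_inf_lt[_ [mu [_ muP] <-] /ltW mue]; exists mu.
Qed.

(** Where [G x] is bounded by [M] off [U], a measure of mass at most
    [(2 * M.+1)^-1] contributes at most 1/2 from outside [U]; if its potential is
    at least 1, half of that comes from inside [U] and can be swept. *)
Lemma swept_piece (A A0 : set X) (M : nat) (e : R) :
  A `<=` P -> A `<=` U -> A0 `<=` U -> countable A0 -> A `<=` closure A0 ->
  A0 !=set0 -> (forall x y, A x -> ~ U y -> G x y <= M%:R%:E) -> (0 < e)%R ->
  exists nu : {measure set (borelType X) -> \bar R},
  [/\ nu (~` A0) = 0, nu setT <= e%:E &
      forall x, A x -> (8^-1)%:E <= (C ^+ 6)%:E * \int[nu]_y G x y].
Proof.
move=> AP AU A0U cA0 AA0 A0n AM e0.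
have M0 : (0 < M.+1%:R :> R)%R by rewrite ltr0n.
have [|mu [mue muP]] := @cstar0_measure (Num.min e (2 * M.+1%:R)^-1)%R.
  by rewrite lt_min e0 invr_gt0 mulr_gt0.
have mUC : measurable (~` U : set (borelType X)) by exact: measurableC.
have muA x : A x -> (4^-1)%:E < \int[mu]_(y in U) G x y.
  move=> Ax; have out : \int[mu]_(y in ~` U) G x y <= (2^-1)%:E.
    apply: (@le_trans _ _ (\int[mu]_(y in ~` U) M.+1%:R%:E)).
      apply: ge0_le_integral => //.
      - exact: measurable_funTS.
      - move=> y Uy; apply: (le_trans (AM x y Ax Uy)).
        by rewrite lee_fin ler_nat.
    rewrite integral_cst//.
    apply: (@le_trans _ _ (M.+1%:R%:E * mu setT)).
      by rewrite lee_pmul2l// le_measure ?inE.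
    apply: (@le_trans _ _ (M.+1%:R%:E * ((2 * M.+1%:R)^-1)%:E)).
      rewrite lee_pmul2l//; apply: le_trans mue _.
      by rewrite lee_fin ge_min lexx orbT.
    by rewrite -EFinM lee_fin invfM mulrCA mulfV ?mulr1// gt_eqF.
  have : \int[mu]_y G x y = \int[mu]_(y in U) G x y + \int[mu]_(y in ~` U) G x y.
    rewrite -[in LHS](setUv U) ge0_integral_setU//; first by rewrite setUv.
    by apply/disj_setPS => y [].
  move=> sumE; have := muP x (AP _ Ax); rewrite sumE => /le_trans/(_ (leeD2l _ out)).
  rewrite -leeBlDr// -EFinB; apply: lt_le_trans.
  rewrite lte_fin; lra.
have t0 : (0 < 4^-1 :> R)%R by rewrite invr_gt0.
have [nu [nu0 nuT nuA]] :=
  sweep AU A0U cA0 AA0 t0 muA A0n.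
exists nu; split=> //.
  by rewrite nuT (le_trans mue)// lee_fin ge_min lexx.
by move=> x /nuA; rewrite (_ : (_ / 2 = 8^-1)%R)//; lra.
Qed.

(** The bound of [G x] off [U] depends on [x]; the pieces of [P] on which it is
    at most [M : nat] are treated separately, with total mass at most [e]. *)
Lemma swept_measure (O : set X) (e : R) :
  open O -> O `<=` U -> P0 `&` O !=set0 -> (0 < e)%R ->
  exists nu : {measure set (borelType X) -> \bar R},
  [/\ nu (~` (P0 `&` O)) = 0, nu setT <= e%:E &
      forall x, P x -> O x -> (8^-1)%:E <= (C ^+ 6)%:E * \int[nu]_y G x y].
Proof.
move=> oO OU A0n e0; have [cP0 P0subP Pcl] := P0P.
have cA0 : countable (P0 `&` O) by apply: sub_countable cP0; exact: subset_card_le.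
pose A (M : nat) := [set x | [/\ P x, O x & forall y, ~ U y -> G x y <= M%:R%:E]].
have /choice[m mP] : forall M, exists nu : {measure set (borelType X) -> \bar R},
    [/\ nu (~` (P0 `&` O)) = 0, nu setT <= (e / (2 ^ M.+1)%:R)%:E &
      forall x, A M x -> (8^-1)%:E <= (C ^+ 6)%:E * \int[nu]_y G x y].
  move=> M; apply: (@swept_piece _ _ M) => //.
  - by move=> x [].
  - by move=> x [_ /OU].
  - by move=> x [_ /OU].
  - move=> x [Px Ox _] V Vx.
    have [y [P0y [Vy Oy]]] := Pcl x Px (V `&` O) (filterI Vx (open_nbhs_nbhs (conj oO Ox))).
    by exists y.
  - by move=> x y [_ _]; apply.
  - by rewrite divr_gt0// ltr0n expn_gt0.
have [| | | |nu [nu0 nuT nuE]] := @combine_measures _ _ R m (P0 `&` O) e.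
- exact: borel_countable.
- exact: ltW.
- by move=> n; case: (mP n).
- by move=> n; case: (mP n).
exists nu; split=> // x Px Ox; rewrite nuE//.
have [|M MP] := Gbnd (x := x) (V := U).
  by apply: open_nbhs_nbhs; split => //; exact: OU.
have [n nM] : exists n : nat, (M <= n%:R)%R.
  by exists (Num.bound `|M|); apply/ltW/(le_lt_trans (ler_norm _))/archi_boundP.
have [_ _ mA] := mP n; apply: (le_trans (mA x _)).
  by split=> // y /MP/le_trans; apply; rewrite lee_fin.
rewrite lee_pmul2l ?lte_fin//.
by apply: (nneseries_term (u := fun n => \int[m n]_y G x y)) => i; exact: integral_ge0.
Qed.

(** The swept measure has its mass at points of [P0], but its potential may be
    infinite at limits of these outside [P]; concentration repairs that.  The
    lower bound does not depend on [e], which is what allows infinitely many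
    such measures of finite total mass to be added up. *)
Lemma local_measure (O : set X) (e : R) : open O -> O `<=` U -> (0 < e)%R ->
  exists nu : {measure set (borelType X) -> \bar R},
  [/\ nu (~` (P0 `&` O)) = 0, nu setT <= e%:E,
      forall x, P x -> O x -> ((16 * C ^+ 10)^-1)%:E <= \int[nu]_y G x y &
      forall x, U x -> ~ P x -> \int[nu]_y G x y < +oo].
Proof.
move=> oO OU e0; have [cP0 P0subP Pcl] := P0P.
have cA0 : countable (P0 `&` O) by apply: sub_countable cP0; exact: subset_card_le.
have [/set0P A0n|A0] := boolP ((P0 `&` O) != set0); last first.
  exists mzero; split=> //.
  - by rewrite lee_fin ltW.
  - move=> x Px Ox; have [y P0Oy] := Pcl x Px O (open_nbhs_nbhs (conj oO Ox)).
    by move: A0; rewrite negbK => /eqP A0; rewrite A0 in P0Oy.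
  - by move=> x _ _; rewrite integral_measure_zero ltry.
have [nu1 [nu10 nu1T nu1P]] := swept_measure oO OU A0n e0.
pose t : R := ((16 * C ^+ 8)^-1)%R.
have AU : P `&` O `<=` U by move=> x [_ /OU].
have A0A : P0 `&` O `<=` P `&` O by move=> x [/P0subP].
have nu1fin : nu1 setT < +oo by exact: le_lt_trans nu1T (ltry _).
have nu1A x : (P `&` O) x -> (C ^+ 2 * t)%:E < \int[nu1]_y G x y.
  move=> [Px Ox]; rewrite -(@lte_pmul2l _ (C ^+ 6)%:E)// ?lte_fin//.
  apply: lt_le_trans (nu1P x Px Ox); rewrite -EFinM lte_fin.
  rewrite mulrA -exprD /t invfM mulrCA mulfV ?mulr1 ?gt_eqF//.
  by rewrite ltf_pV2 ?posrE// ltr_nat.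
have [nu [nu0 nuT nuP nufin]] :=
  concentrate AU A0A cA0 nu10 nu1fin nu1A A0n.
exists nu; split => //.
- by rewrite nuT.
- move=> x Px Ox; rewrite -(@lee_pmul2l _ (C ^+ 2)%:E)// ?lte_fin//.
  apply: le_trans (nuP x (conj Px Ox)); rewrite -EFinM lee_fin /t.
  rewrite (exprD C 2 8 : (C ^+ 10 = C ^+ 2 * C ^+ 8)%R) mulrCA invfM mulrA.
  by rewrite mulfV ?mul1r// gt_eqF.
- by move=> x Ux nPx; apply: nufin => // -[/P0subP].
Qed.

(** Cover [W] by pieces [Q i] seen from [U] off [W] below some bound [M i], and
    divide the masses by [M i + 1]: the potential becomes small off [W].  By local
    finiteness it remains finite at the points of [W] off [P]. *)
Lemma layer_measure (W : set X) (e : R) : open W -> W `<=` U -> (0 < e)%R ->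
  exists nu : {measure set (borelType X) -> \bar R},
  [/\ nu (~` (P0 `&` W)) = 0, nu setT <= e%:E,
      forall x, P x -> W x -> ((16 * C ^+ 10)^-1)%:E <= \int[nu]_y G x y,
      forall x, U x -> ~ W x -> \int[nu]_y G x y <= e%:E &
      forall x, U x -> ~ P x -> \int[nu]_y G x y < +oo].
Proof.
move=> oW WU e0.
have e2 i : (0 < e / (2 ^ i.+1)%:R)%R by rewrite divr_gt0// ltr0n expn_gt0.
pose good (Q : set X) := exists2 M : R, (0 <= M)%R &
  forall x y, U x -> ~ W x -> Q y -> G x y <= M%:E.
have [|V V' VV' [M M0 MP]|x Wx|Q [oQ WE Qfin]] :=
  @locally_finite_refinement X lcX hX scX W good.
- by exists 0%R => // x y _ _ [].
- by exists M => // x y Ux nW /VV'; exact: MP.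
- have [V [M [oV Vx VW M0 MP]]] := kernel_bounded_away oW Wx WU.
  by exists V; split=> //; exists M.
have QW i : Q i `<=` W by rewrite WE => y Qy; exists i.
have /choice[M MP] : forall i, exists M : R, (0 <= M)%R /\
    forall x y, U x -> ~ W x -> Q i y -> G x y <= M%:E.
  by move=> i; have [_ [M M0 MP]] := oQ i; exists M.
have M1 i : (0 < M i + 1)%R by rewrite ltr_wpDl//; case: (MP i).
have /choice[m mP] : forall i, exists nu : {measure set (borelType X) -> \bar R},
  [/\ nu (~` (P0 `&` Q i)) = 0, nu setT <= (e / (2 ^ i.+1)%:R / (M i + 1))%:E,
      forall x, P x -> Q i x -> ((16 * C ^+ 10)^-1)%:E <= \int[nu]_y G x y &
      forall x, U x -> ~ P x -> \int[nu]_y G x y < +oo].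
  move=> i; apply: local_measure.
  - by case: (oQ i).
  - exact: subset_trans WU.
  - by rewrite divr_gt0.
have mT i : m i setT <= (e / (2 ^ i.+1)%:R)%:E.
  have [_ /le_trans + _ _] := mP i; apply; rewrite lee_fin ler_pdivrMr//.
  have M1' : (1 <= M i + 1)%R by rewrite lerDr; case: (MP i).
  by rewrite ler_peMr// ltW.
have mA i : m i (~` (P0 `&` W)) = 0.
  have [mi0 _ _ _] := mP i; apply: (carrier_subset hX _ _ mi0) => //.
  by move=> y [? /QW].
have [nu [nu0 nuT nuE]] :=
  combine_measures (borel_countable hX (cP0O _)) (ltW e0) mA mT.
have {}nuE x : \int[nu]_y G x y = \sum_(i <oo) \int[m i]_y G x y.
  by rewrite nuE.
have m0 x i : 0 <= \int[m i]_y G x y by exact: integral_ge0.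
have small x : U x -> ~ W x -> \int[nu]_y G x y <= e%:E.
  move=> Ux nWx; rewrite nuE; apply: le_trans (epsilon_trick0 xpredT (ltW e0)).
  apply: lee_nneseries => // i _; have [mi0 miT _ _] := mP i.
  have [Mi0 Mi] := MP i.
  apply: (@le_trans _ _ ((M i)%:E * m i setT)).
    by apply: (potential_le_mass hX G0 mG _ mi0) => // y [_ Qy]; exact: Mi.
  apply: (@le_trans _ _ ((M i)%:E * (e / (2 ^ i.+1)%:R / (M i + 1))%:E)).
    by rewrite lee_wpmul2l.
  rewrite -EFinM lee_fin mulrCA; apply: ler_piMr; first exact: ltW.
  by rewrite ler_pdivrMr// mul1r lerDl.
exists nu; split=> //.
- move=> x Px; rewrite WE => -[i _ Qx]; have [_ _ mi _] := mP i.
  rewrite nuE; apply: (le_trans (mi x Px Qx)).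
  exact: (nneseries_term (u := fun i => \int[m i]_y G x y)).
- move=> x Ux nPx; have [Wx|nWx] := pselect (W x); last first.
    by apply: (le_lt_trans (small x Ux nWx)); rewrite ltry.
  have [V [n [oV Vx Vn]]] := Qfin x Wx.
  have [N N0 NP] := bounded_off_nbhs Gbnd oV Vx.
  rewrite nuE; apply: (@nneseries_lty _ _ n (N * e)) => //.
  + by rewrite mulr_ge0// ltW.
  + by move=> i _; have [_ _ _ mi] := mP i; exact: mi.
  move=> i ni; have [mi0 _ _ _] := mP i.
  apply: (@le_trans _ _ (N%:E * m i setT)).
    apply: (potential_le_mass hX G0 mG _ mi0) => // y [_ Qy]; apply: NP => Vy.
    by have : (Q i `&` V) y by []; rewrite Vn.
  by rewrite -mulrA EFinM lee_wpmul2l.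
Qed.

(** Take layers for open sets [W n] decreasing to the part of [P] in [O].  At each
    point of that part all layers contribute the same positive amount, so that
    the sum diverges; a point of [U] off [P] lies outside almost all [W n], where
    the contributions are summable.  Points off [U] are separated from [O]. *)
Lemma exact_local (O : set X) (e : R) : Gdelta P ->
  open O -> closure O `<=` U -> (0 < e)%R ->
  exists nu : {measure set (borelType X) -> \bar R},
  [/\ nu (~` (P0 `&` O)) = 0, nu setT <= e%:E,
      forall x, P x -> O x -> \int[nu]_y G x y = +oo &
      forall x, ~ P x -> \int[nu]_y G x y < +oo].
Proof.
move=> [V oV PE] oO clOU e0.
pose W n := O `&` \big[setI/setT]_(k < n.+1) V k.
have WO n : W n `<=` O by move=> x [].
have OU : O `<=` U by apply: subset_trans clOU; exact: subset_closure.
have oW n : open (W n).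
  by apply: openI => //; elim/big_ind : _ => //; [exact: openT|exact: openI].
have PW n x : P x -> O x -> W n x.
  move=> + Ox; rewrite PE => Px; split => //.
  by rewrite -bigcap_mkord => k _; exact: Px.
have e2 i : (0 < e / (2 ^ i.+1)%:R)%R by rewrite divr_gt0// ltr0n expn_gt0.
have /choice[m mP] n := layer_measure (oW n) (subset_trans (WO n) OU) (e2 n).
have mA n : m n (~` (P0 `&` O)) = 0.
  have [mn0 _ _ _ _] := mP n; apply: (carrier_subset hX _ _ mn0) => //.
  by move=> y [? /WO].
have mT n : m n setT <= (e / (2 ^ n.+1)%:R)%:E by case: (mP n).
have [nu [nu0 nuT nuE]] :=
  combine_measures (borel_countable hX (cP0O _)) (ltW e0) mA mT.
have {}nuE x : \int[nu]_y G x y = \sum_(n <oo) \int[m n]_y G x y.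
  by rewrite nuE.
exists nu; split=> //.
- move=> x Px Ox; rewrite nuE; apply: (@nneseries_infty _ _ (16 * C ^+ 10)^-1).
    by rewrite invr_gt0 mulr_gt0// exprn_gt0// (lt_le_trans _ C2).
  by move=> n; have [_ _ mn _ _] := mP n; apply: mn => //; exact: PW.
move=> x nPx; have [Ux|nUx] := pselect (U x); last first.
  have [||N N0 NP] := @bounded_off_nbhs _ _ _ Gbnd x (~` closure O).
  - by apply: closed_openC; exact: closed_closure.
  - by move=> /clOU.
  apply: (@le_lt_trans _ _ (N%:E * nu setT)).
    apply: (potential_le_mass hX G0 mG _ nu0) => // y [_ Oy]; apply: NP.
    by move=> /(_ (subset_closure Oy)).
  by rewrite lte_mul_pinfty// (le_lt_trans nuT)// ltry.
have [n nVx] : exists n, ~ V n x.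
  by apply: contrapT => /forallNP nV; apply: nPx; rewrite PE => n _; apply: contrapT; exact: nV.
rewrite nuE; apply: (@nneseries_lty _ _ n e) => //.
- by move=> i; exact: integral_ge0.
- exact: ltW.
- by move=> i _; have [_ _ _ _ mi] := mP i; exact: mi.
move=> i ni; have [_ _ _ mi _] := mP i; apply: mi => // -[_].
rewrite -bigcap_mkord => /(_ n)/=; rewrite ltnS => /(_ (ltnW ni)).
exact: nVx.
Qed.

End exact_local.

End triangle_kernel.

(** * Finite Radon measures *)

Section radon_measures.
Context (R : realType) (X : ptopologicalType).
Hypothesis hX : hausdorff_space X.

(** The constructions above yield mere measures; this packages them. *)
Lemma finite_measure_of (nu : {measure set (borelType X) -> \bar R}) :
  nu setT < +oo ->
  exists mu : {finite_measure set (borelType X) -> \bar R},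
    forall B, mu B = nu B.
Proof.
move=> nuT; have nu_fin : fin_num_fun nu by exact: lty_fin_num_fun.
have nu_sigma : sigma_finite setT nu.
  by apply: fin_num_fun_sigma_finite => //; rewrite measure0.
pose H1 := isFinite.Build _ _ _ _ nu_fin.
pose H2 := isSFinite.Build _ _ _ _ (sfinite_measure_sigma_finite nu_sigma).
pose H3 := isSigmaFinite.Build _ _ _ _ nu_sigma.
pose mu := HB.pack_for (FiniteMeasure.type (borelType X) R) (Measure.sort nu) H1 H2 H3.
by exists mu.
Qed.

Lemma le_radon_sup (mu : {finite_measure set (borelType X) -> \bar R})
    (B : set (borelType X)) : measurable B ->
  ereal_sup [set mu K | K in [set K | @compact X K /\ K `<=` B]] <= mu B.
Proof.
move=> mB; apply: ge_ereal_sup => _ [K [cK KB] <-].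
apply: le_measure => //; rewrite inE//.
by apply: borel_closed; exact: compact_closed.
Qed.

(** A set meets the carrier in an increasing union of finite, hence compact,
    sets. *)
Lemma countable_radon (mu : {finite_measure set (borelType X) -> \bar R})
    (A : set X) : countable A -> mu (~` A) = 0 -> radon mu.
Proof.
move=> cA muA B mB; apply/eqP; rewrite eq_le le_radon_sup// andbT.
have mA : measurable (A : set (borelType X)) by exact: borel_countable.
set s := ereal_sup _.
have finite_le (K : set X) : finite_set K -> K `<=` B -> mu K <= s.
  by move=> fK KB; apply: ereal_sup_ubound; exists K => //; split=> //; exact: finite_compact.
have muBA : mu B = mu (B `&` A).
  rewrite (measureDI mu mB mA) (subset_measure0 _ _ _ muA) ?add0e//.
  - exact: measurableD.
  - exact: measurableC.
have [[a Aa]|A0] := pselect (A !=set0); last first.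
  rewrite muBA (_ : B `&` A = set0) ?measure0.
    have := finite_le set0 (finite_set0 _); rewrite measure0; exact.
  by rewrite -subset0 => y [_ Ay]; apply: A0; exists y.
have [p pE] := nonempty_countable_range cA (ex_intro _ a Aa).
have Ap k : A (p k) by rewrite -pE; exists k.
pose F n := B `&` p @` `I_n.
have fF n : finite_set (F n).
  by apply: finite_setIr; apply: finite_image; exact: finite_II.
have mF n : measurable (F n : set (borelType X)).
  by apply: borel_countable => //; exact: finite_set_countable.
have UF : \bigcup_n F n = B `&` A.
  apply/seteqP; split=> [y [n _ [By [k kn pky]]]|y [By]].
    by split=> //; rewrite -pky.
  by rewrite -pE => -[k _ pky]; exists k.+1 => //; split => //; exists k => /=.
have cF : mu (F n) @[n --> \oo] --> mu (\bigcup_n F n).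
  apply: nondecreasing_cvg_mu => //; first exact: bigcupT_measurable.
  move=> m n mn; apply/subsetPset => y [By [k /= km pk]]; split=> //; exists k => //=.
  exact: leq_trans mn.
rewrite muBA -UF -(cvg_lim _ cF)//; apply: lime_le.
  by apply/cvg_ex; eexists; exact: cF.
by apply: nearW => n; apply: finite_le => // y [].
Qed.

Lemma radon_scale (mu nu : {finite_measure set (borelType X) -> \bar R}) (r : R) :
  (0 < r)%R -> (forall B, nu B = r%:E * mu B) -> radon mu -> radon nu.
Proof.
move=> r0 nuE rmu B mB; apply/eqP; rewrite eq_le le_radon_sup// andbT.
rewrite nuE -lee_pdivlMl// rmu//; apply: ge_ereal_sup => _ [K KB <-].
rewrite lee_pdivlMl// -nuE; apply: ereal_sup_ubound.
by exists K.
Qed.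

End radon_measures.

(** * The equivalence *)

Section equivalence.
Context (R : realType) (X : ptopologicalType).
Hypotheses (lcX : locally_compact [set: X]) (hX : hausdorff_space X).
Hypothesis scX : @second_countable X.
Variables (G : X -> X -> \bar R).
Hypothesis mG : borel_kernel G.
Hypothesis G0 : forall x y, 0 < G x y.
Hypothesis Gsing : singular_on_diagonal G.
Hypothesis Gbnd : bounded_off_diagonal G.
Hypothesis Gtri : local_triangle_property G.

Let Gge0 x y : 0 <= G x y. Proof. exact: ltW. Qed.
Let mGx x : measurable_fun [set: borelType X] (G x : borelType X -> \bar R).
Proof. exact: borel_kernel_section. Qed.

Lemma triangle_nbhs x : exists (U : set X) (C : R),
  [/\ open U, U x, (2 <= C)%R & forall x y z, U x -> U y -> U z ->
    mine (G x z) (G y z) <= C%:E * G x y].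
Proof.
have [U [oU Ux [C C0 CP]]] := Gtri x; exists U, (Num.max C 2)%R; split=> //.
  by rewrite le_max lexx orbT.
move=> a b c Ua Ub Uc; apply: (le_trans (CP a b c Ua Ub Uc)).
by rewrite lee_wpmul2r// lee_fin le_max lexx.
Qed.

(** The set is the intersection of the interiors of [n <= potential]: at a point of
    infinite potential the part inside a triangle neighbourhood is infinite, and
    the bulks of that part are open. *)
Lemma potential_infty_Gdelta (mu : {finite_measure set (borelType X) -> \bar R}) :
  Gdelta [set x | potential G mu x = +oo].
Proof.
pose F n := [set x | n%:R%:E <= potential G mu x]°.
exists F; first by move=> n; exact: open_interior.
apply/seteqP; split=> [x /= xoo n _|x xF]; last first.
  apply/eqyP => A A0; have /= := interior_subset (xF (Num.bound A) I).
  by apply: le_trans; rewrite lee_fin ltW// archi_boundP// ltW.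
have [U [C [oU Ux C2 tri]]] := triangle_nbhs x.
have mU : measurable (U : set (borelType X)) by exact: borel_open.
have mUC : measurable (~` U : set (borelType X)) by exact: measurableC.
have sumE y : potential G mu y =
    \int[mu]_(z in U) G y z + \int[mu]_(z in ~` U) G y z.
  rewrite /potential -[in LHS](setUv U) ge0_integral_setU//; first by rewrite setUv.
  by apply/disj_setPS => z [].
have Uoo : \int[mu]_(z in U) G x z = +oo.
  have [M M0 MP] := bounded_off_nbhs Gbnd oU Ux.
  have outfin : \int[mu]_(z in ~` U) G x z < +oo.
    apply: (@le_lt_trans _ _ (\int[mu]_(z in ~` U) M%:E)).
      by apply: ge0_le_integral => //; exact: measurable_funTS.
    by rewrite integral_cst// lte_mul_pinfty// -ge0_fin_numE// fin_num_measure.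
  apply/eqP; rewrite -leye_eq leNgt; apply/negP => Ufin.
  by have := lte_add_pinfty Ufin outfin; rewrite -sumE xoo ltxx.
have xb := potential_infty_bulk C2 G0 mG Gsing oU tri mU (@subset_refl _ U) n%:R Ux Uoo.
suff bF : bulk G U mu U n%:R `<=` [set x | n%:R%:E <= potential G mu x].
  by apply: (filterS bF); apply: open_nbhs_nbhs; split=> //; exact: open_bulk.
move=> y [B [N [_ By _ BN]]] /=; apply: (le_trans (BN y By)).
apply: (le_trans (truncated_le G0 mG mu mU y N)).
by rewrite sumE leeDl// integral_ge0.
Qed.

(** Small multiples of [mu] still have infinite potential on [P]. *)
Lemma potential_infty_cstar (P : set X)
    (mu : {finite_measure set (borelType X) -> \bar R}) :
  radon mu -> (forall x, P x -> potential G mu x = +oo) -> cstar G P = 0.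
Proof.
move=> rmu muP; apply/eqP; rewrite eq_le; apply/andP; split; last first.
  by apply: le_ereal_inf_tmp => _ [nu _ <-]; exact: measure_ge0.
apply/lee_addgt0Pr => e e0; rewrite add0e.
have mufin : mu setT \is a fin_num by exact: fin_num_measure.
pose r := (e / (fine (mu setT) + 1))%R.
have m1 : (0 < fine (mu setT) + 1)%R by rewrite ltr_wpDl// fine_ge0.
have r0 : (0 < r)%R by rewrite divr_gt0.
pose rn : {nonneg R} := NngNum (ltW r0).
have [|nu nuE] := @finite_measure_of R X (mscale rn mu).
  by rewrite /mscale/= lte_mul_pinfty ?lee_fin ?ltW// -ge0_fin_numE.
have nuT : nu setT <= e%:E.
  rewrite nuE; apply: (@le_trans _ _ (r%:E * (fine (mu setT))%:E)); first by rewrite fineK.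
  rewrite -EFinM lee_fin /r mulrAC ler_pdivrMr//.
  by rewrite ler_pM2l// lerDl.
apply: le_trans nuT; apply: ereal_inf_lbound; exists nu => //; split.
  split; last by rewrite setCT measure0.
  exact: (radon_scale hX r0 (fun B => nuE B) rmu).
move=> x /muP; rewrite /potential => xoo.
rewrite (eq_measure_integral (mscale rn mu)); last by move=> B mB _; exact: nuE.
rewrite ge0_integral_mscale// [X in _ * X]xoo mulry gtr0_sg// mul1e leey//.
Qed.

Variables (P P0 : set X).
Hypothesis P0P : countable_dense_in P0 P.

(** Local solutions for a locally finite cover of the space by open sets with
    closure in triangle neighbourhoods add up: at a point off [P], finitely many
    of them have finite potential, and the carriers of the others avoid a
    neighbourhood of the point. *)
Lemma exact_measure : Gdelta P -> cstar G P = 0 ->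
  exists2 mu, radon_on P0 mu & [set x | potential G mu x = +oo] = P.
Proof.
move=> GP cP; have [cP0 _ _] := P0P.
pose good (O : set X) := O = set0 \/ exists (U : set X) (C : R),
  [/\ open U, (2 <= C)%R, forall x y z, U x -> U y -> U z ->
    mine (G x z) (G y z) <= C%:E * G x y & closure O `<=` U].
have [|V W VW [W0|[U [C [oU C2 tri WU]]]]|x _|O [oO OT Ofin]] :=
  @locally_finite_refinement X lcX hX scX setT good.
- by left.
- by left; rewrite -subset0 -W0.
- by right; exists U, C; split => //; apply: subset_trans WU; exact: closureS.
- have [U [C [oU Ux C2 tri]]] := triangle_nbhs x.
  have [V [oV Vx VU]] := open_shrink lcX hX oU Ux.
  by exists V; split=> //; right; exists U, C.
have e2 i : (0 < (1 : R) / (2 ^ i.+1)%:R)%R by rewrite divr_gt0// ltr0n expn_gt0.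
have /choice[m mP] : forall i, exists nu : {measure set (borelType X) -> \bar R},
  [/\ nu (~` (P0 `&` O i)) = 0, nu setT <= (1 / (2 ^ i.+1)%:R)%:E,
      forall x, P x -> O i x -> \int[nu]_y G x y = +oo &
      forall x, ~ P x -> \int[nu]_y G x y < +oo].
  move=> i; have [oOi [Oi0|[U [C [oU C2 tri OU]]]]] := oO i.
    exists mzero; split=> //.
    - by rewrite lee_fin ltW.
    - by move=> x _; rewrite Oi0.
    - by move=> x _; rewrite integral_measure_zero ltry.
  exact: (exact_local lcX hX scX C2 G0 mG Gsing Gbnd oU tri P0P cP GP oOi OU (e2 i)).
have mA i : m i (~` P0) = 0.
  have [mi0 _ _ _] := mP i; apply: (carrier_subset hX cP0 _ mi0).
  by move=> y [].
have mT i : m i setT <= (1 / (2 ^ i.+1)%:R)%:E by case: (mP i).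
have [nu [nu0 nuT nuE]] :=
  combine_measures (borel_countable hX cP0) (@ler01 R) mA mT.
have {}nuE x : \int[nu]_y G x y = \sum_(n <oo) \int[m n]_y G x y.
  by rewrite nuE.
have m0 x i : 0 <= \int[m i]_y G x y by exact: integral_ge0.
have [|mu muE] := @finite_measure_of R X nu.
  by rewrite (le_lt_trans nuT)// ltry.
have mu0 : mu (~` P0) = 0 by rewrite muE.
exists mu; first by split=> //; exact: (countable_radon hX cP0).
have potE x : potential G mu x = \sum_(n <oo) \int[m n]_y G x y.
  by rewrite -nuE; apply: eq_measure_integral => B mB _; exact: muE.
apply/seteqP; split=> [x /=|x Px /=]; rewrite potE; last first.
  have [i _ Ox] : (\bigcup_i O i) x by rewrite -OT.
  have [_ _ mi _] := mP i.
  by apply: (@nneseries_pinfty _ (fun n => \int[m n]_y G x y) xpredT i) => //; exact: mi.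
apply: contraPP => nPx; apply/eqP; rewrite lt_eqF//.
have [V [n [oV Vx Vn]]] := Ofin x I.
have [N N0 NP] := bounded_off_nbhs Gbnd oV Vx.
apply: (@nneseries_lty _ _ n N) => //.
  by move=> i _; have [_ _ _ mi] := mP i; exact: mi.
move=> i ni; have [mi0 miT _ _] := mP i.
apply: (@le_trans _ _ (N%:E * m i setT)).
  have cPO : countable (P0 `&` O i) by apply: sub_countable cP0; exact: subset_card_le.
  apply: (potential_le_mass hX G0 mG cPO mi0) => // y [_ Oy]; apply: NP => Vy.
  by have : (O i `&` V) y by []; rewrite Vn.
by rewrite -[N in leRHS]mulr1 -mulrA EFinM lee_wpmul2l.
Qed.

End equivalence.

Unset Implicit Arguments.

Theorem theorem1p3 (R : realType) (X : ptopologicalType)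
    (lcX : locally_compact [set: X]) (hX : hausdorff_space X)
    (scX : @second_countable X)
    (G : X -> X -> \bar R) (mG : borel_kernel G)
    (G_gt0 : forall x y, 0 < G x y)
    (G_sing : singular_on_diagonal G) (G_bnd : bounded_off_diagonal G)
    (G_tri : local_triangle_property G)
    (P P0 : set X) (P0P : countable_dense_in P0 P) :
  ((Gdelta P /\ cstar G P = 0) <->
    (exists2 mu, radon_on P mu & [set x | potential G mu x = +oo] = P)) /\
  ((exists2 mu, radon_on P mu & [set x | potential G mu x = +oo] = P) <->
    (exists2 mu, radon_on P0 mu & [set x | potential G mu x = +oo] = P)).
Proof.
have [cP0 P0subP _] := P0P.
have i_iii : Gdelta P /\ cstar G P = 0 ->
    exists2 mu, radon_on P0 mu & [set x | potential G mu x = +oo] = P.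
  by move=> [GP cP]; exact: exact_measure.
have iii_ii : (exists2 mu, radon_on P0 mu & [set x | potential G mu x = +oo] = P) ->
    exists2 mu, radon_on P mu & [set x | potential G mu x = +oo] = P.
  move=> [mu [rmu mu0] muP]; exists mu => //; split=> //.
  apply: (subset_measure0 _ _ _ mu0).
  - rewrite -muP; apply: (@measurableC _ (borelType X)); apply: borel_Gdelta.
    exact: potential_infty_Gdelta.
  - by apply: (@measurableC _ (borelType X)); exact: borel_countable.
  - exact: subsetC.
have ii_i : (exists2 mu, radon_on P mu & [set x | potential G mu x = +oo] = P) ->
    Gdelta P /\ cstar G P = 0.
  move=> [mu [rmu _] muP]; split.
    by rewrite -muP; exact: potential_infty_Gdelta.
  by apply: (potential_infty_cstar hX mG G_gt0 rmu); rewrite -muP.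
split; split=> //.
- by move=> /i_iii/iii_ii.
- by move=> /ii_i/i_iii.
Qed.
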